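(* Let $n\ge 3$ and let $k_1,\dots,k_n\in\mathbb{Z}_{\ge0}$ with $\sum_{i=1}^nk_i=n-3$, so that the intersection product $\Psi_1^{k_1}\cdot\ldots\cdot\Psi_n^{k_n}$ of tropical Psi-classes on $\mathcal{M}_{0,n}$ is $0$-dimensional. Then $\Psi_1^{k_1}\cdot\ldots\cdot\Psi_n^{k_n}$ is just the origin $\{0\}$, with weight $$\omega(\{0\})=\frac{(n-3)!}{k_1!\cdots k_n!}=\binom{n-3}{k_1,\dots,k_n}.$$
   Context: Let $n\ge 3$ be an integer and $[n]=\{1,\dots,n\}$. **Tropical curves and $\mathcal{M}_{0,n}$.** An $n$-marked (rational) abstract tropical curve is a tree without 2-valent vertices, with $n$ leaves (unbounded edges) labeled $1,\dots,n$, together with a positive real length for each bounded (non-leaf) edge. Its combinatorial type is the underlying labeled tree without lengths. $\mathcal{M}_{0,n}$ is the set of all such curves; curves of a fixed type with $r$ bounded edges form an open cone $\mathbb{R}_{>0}^r$, and cones are glued so that faces correspond to contracting bounded edges. **Embedding.** Let $\mathcal{T}$ be the set of two-element subsets of $[n]$, $\Phi_n:\mathbb{R}^n\to\mathbb{R}^{\binom n2}$, $a\mapsto(a_i+a_j)_{\{i,j\}\in\mathcal{T}}$, and $Q_n=\mathbb{R}^{\binom n2}/\operatorname{im}(\Phi_n)$. The map $\varphi_n:\mathcal{M}_{0,n}\to Q_n$ sends $C$ to the class of $(\operatorname{dist}(\{i,j\}))_{\{i,j\}}$, where $\operatorname{dist}(\{i,j\})$ is the sum of the lengths of the bounded edges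 on the path between leaves $i$ and $j$. For $I\subset[n]$ let $v_I\in\mathbb{R}^{\binom n2}$ (and its class in $Q_n$) be given by $(v_I)_T=1$ if $|I\cap T|=1$ and $(v_I)_T=0$ otherwise. For $1<|I|<n-1$, $v_I=v_{[n]\setminus I}$ is the image of the tree with one bounded edge of length one separating the labels in $I$ from those in $[n]\setminus I$. It is known that $\varphi_n$ embeds $\mathcal{M}_{0,n}$ as a pure $(n-3)$-dimensional simplicial balanced fan, all facets having weight 1, with respect to the lattice in $Q_n$ generated by the $v_I$. The closed cone of a combinatorial type is generated by the $v_I$ with $I$ running over the splits of $[n]$ given by its bounded edges. If a cone $\tau$ is a codimension-one face of a cone $\sigma$, the primitive vector $u_{\sigma/\tau}$ is $v_I$, where $I$ is the split given by the edge contracted in passing from $\sigma$ to $\tau$. **Divisors.** Let $Z$ be a weighted balanced fan whose cones are closed cones of $\mathcal{M}_{0,n}$ and let $\varphi$ be a continuous function linear on each cone. For a cone $\sigma$ let $\varphi_\sigma$ be the linear function on the span of $\sigma$ that agrees with $\varphi$ on $\sigma$. The divisor of $\varphi$ on $Z$ is the codimension-one skeleton of $Z$ with weights $$\omega(\tau)=\sum_{\sigma\supset\tau}\varphi_\sigma\big(\omega(\sigma)u_{\sigma/\tau}\big)-\varphi_\tau\Big(\sum_{\sigma\supset\tau}\omega(\sigma)u_{\sigma/\tau}\Big),$$ the sums running over the facets $\sigma$ of $Z$ containing $\tau$; cones of weight 0 are discarded. **Functions $f_k$ and Psi-classes.** For $k\in[n]$ every $v\in Q_n$ has a unique representation $v=\sum_S\lambda_Sv_S$,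 $S$ running over the two-element subsets of $[n]\setminus\{k\}$, with all $\lambda_S\ge0$ and at least one $\lambda_S=0$. Put $f_k(v)=\sum_S\lambda_S$; this function is linear on every cone of $\mathcal{M}_{0,n}$. The tropical Psi-class $\Psi_k$ is the weighted fan of those closed $(n-4)$-dimensional cones of $\mathcal{M}_{0,n}$ corresponding to curves in which leaf $k$ is adjacent to a 4-valent vertex, each with weight 1. The divisor of $f_k$ on $\mathcal{M}_{0,n}$ is $\binom{n-1}{2}\Psi_k$, and accordingly the intersection product with $\Psi_k$ of a weighted balanced fan $Z$ whose cones are closed cones of $\mathcal{M}_{0,n}$ is $\Psi_k\cdot Z=\binom{n-1}{2}^{-1}\cdot(\text{divisor of } f_k \text{ on } Z)$. The product $\Psi_1^{k_1}\cdots\Psi_n^{k_n}$ is obtained from $\mathcal{M}_{0,n}$ by successively multiplying $k_i$ times with $\Psi_i$ for each $i$, in any order; the empty product is $\mathcal{M}_{0,n}$. *)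

(* Defs.v *)
From HB Require Import structures.
From mathcomp Require Import all_boot all_order all_algebra.
From mathcomp Require Import all_classical reals.
Set Implicit Arguments.
Unset Strict Implicit.
Unset Printing Implicit Defensive.
Import GRing.Theory Num.Theory.
Local Open Scope ring_scope.

Definition valence (V : finType) (adj : rel V) (v : V) : nat :=
  #|[set w | adj v w]%SET|.

(* The combinatorial type of an n-marked rational tropical curve. An unbounded
   edge is represented as an edge ending in a 1-valent vertex, so that labelling
   the unbounded edges is a bijection of 'I_n with the 1-valent vertices. A tree
   is a connected simple graph without simple cycles of length at least 3. *)
Record marked_tree (n : nat) := MarkedTree {
  vertex : finType;
  adj : rel vertex;
  leaf : 'I_n -> vertex;
  adj_sym : symmetric adj;
  adj_irr : irreflexive adj;
  adj_connected : forall x y, connect adj x y;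
  adj_acyclic : forall p : seq vertex, ucycle adj p -> (size p < 3)%N;
  leaf_inj : injective leaf;
  leaf_valence : forall v, (valence adj v == 1%N) = (v \in codom leaf);
  no_2valent : forall v, valence adj v != 2%N
}.

Section Splits.
Variables (n : nat) (C : marked_tree n).

Definition bounded_edge (x y : vertex C) : bool :=
  [&& adj x y, x \notin codom (@leaf n C) & y \notin codom (@leaf n C)].

Definition bounded_edges : {set {set vertex C}} :=
  [set e | [exists x, exists y, bounded_edge x y && (e == [set x; y])]]%SET.

Definition delete_edge (x y : vertex C) : rel (vertex C) :=
  fun a b => adj a b && ([set a; b] != [set x; y])%SET.

(* The labels on the side of x after removing the edge xy. *)
Definition side (x y : vertex C) : {set 'I_n} :=
  [set i | connect (delete_edge x y) x (leaf C i)]%SET.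

(* Both parts I and [n] \ I of each split are listed; v_I is the same for both. *)
Definition splits : {set {set 'I_n}} :=
  [set I | [exists x, exists y, bounded_edge x y && (I == side x y)]]%SET.

End Splits.

Definition pairs (n : nat) := {T : {set 'I_n} | #|T| == 2%N}.

Section Qn.
Variables (R : realType) (n : nat).

Definition Phi (a : 'I_n -> R) : {ffun pairs n -> R^o} :=
  [ffun T : pairs n => (\sum_(i in val T) a i : R^o)].

Definition im_Phi : {pred {ffun pairs n -> R^o}} :=
  fun x => `[< exists a, x = Phi a >].

Lemma im_Phi_submod : submod_closed im_Phi.
Proof.
split=> [|c x y].
  apply/asboolP; exists (fun=> 0); apply/ffunP => T.
  by rewrite !ffunE big1.
move=> /asboolP[a ->] /asboolP[b ->]; apply/asboolP.
exists (fun i => c * a i + b i); apply/ffunP => T.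
rewrite !ffunE big_split; congr (_ + _); exact: mulr_sumr.
Qed.

HB.instance Definition _ :=
  GRing.isSubmodClosed.Build R {ffun pairs n -> R^o} im_Phi im_Phi_submod.

Definition Qn : Type := Quotient.quot im_Phi.

HB.instance Definition _ := GRing.Zmodule.on Qn.

Definition toQ (x : {ffun pairs n -> R^o}) : Qn :=
  (\pi_(Quotient.quot im_Phi) x)%qT.

Definition scaleQ (c : R) (v : Qn) : Qn :=
  toQ (c *: repr (v : Quotient.quot im_Phi)).

Lemma toQ_eqP x y : reflect (exists a, x - y = Phi a) (toQ x == toQ y).
Proof.
have -> : (toQ x == toQ y) = (x - y \in im_Phi) by rewrite Quotient.idealrBE.
exact: asboolP.
Qed.

Lemma toQ_repr (v : Qn) : toQ (repr (v : Quotient.quot im_Phi)) = v.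
Proof. exact: reprK. Qed.

Lemma toQ_add x y : toQ (x + y) = toQ x + toQ y.
Proof. exact: (@Quotient.pi_add _ im_Phi). Qed.

Lemma toQ_scale c x : toQ (c *: x) = scaleQ c (toQ x).
Proof.
apply/eqP; rewrite /scaleQ/toQ -Quotient.idealrBE -scalerBr.
by apply: rpredZ; rewrite Quotient.idealrBE reprK.
Qed.

Lemma scaleQA c d v : scaleQ c (scaleQ d v) = scaleQ (c * d) v.
Proof. by rewrite -[v]toQ_repr -!toQ_scale scalerA. Qed.

Lemma scaleQ1 : left_id 1 scaleQ.
Proof. by move=> v; rewrite -[v]toQ_repr -toQ_scale scale1r. Qed.

Lemma scaleQDr : right_distributive scaleQ +%R.
Proof.
move=> c u v; rewrite -[u]toQ_repr -[v]toQ_repr.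
by rewrite -toQ_add -!toQ_scale -toQ_add scalerDr.
Qed.

Lemma scaleQDl v : {morph scaleQ^~ v : c d / c + d}.
Proof.
by move=> c d; rewrite -[v]toQ_repr -!toQ_scale -toQ_add scalerDl.
Qed.

HB.instance Definition _ :=
  GRing.Zmodule_isLmodule.Build R Qn scaleQA scaleQ1 scaleQDr scaleQDl.

Definition vI (I : {set 'I_n}) : Qn :=
  toQ [ffun T : pairs n => ((#|I :&: val T| == 1%N)%:R : R^o)].

Definition generated_cone (G : {set {set 'I_n}}) : set Qn :=
  [set v | exists l : {set 'I_n} -> R,
     (forall I, 0 <= l I) /\ v = \sum_(I in G) l I *: vI I]%classic.

(* The closed cone of a combinatorial type. *)
Definition type_cone (C : marked_tree n) : set Qn := generated_cone (splits C).

(* tau is the face of sigma obtained by contracting a bounded edge whose split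
   is {I, ~: I}. *)
Definition contraction (sigma tau : set Qn) (I : {set 'I_n}) : Prop :=
  exists (C : marked_tree n) (x y : vertex C),
    [/\ bounded_edge x y, I = side x y, sigma = type_cone C
      & tau = generated_cone (splits C :\: [set I; ~: I])%SET].

Definition codim1_face (tau sigma : set Qn) : Prop :=
  exists I, contraction sigma tau I.

(* u_{sigma/tau}: all I with contraction sigma tau I have the same class. *)
Definition primitive (sigma tau : set Qn) : Qn :=
  xget 0 [set u | exists2 I, contraction sigma tau I & u = vI I]%classic.

(* A pure weighted fan, given by its facets; weight is only meaningful on them. *)
Record weighted_fan := WeightedFan {
  facets : set (set Qn);
  weight : set Qn -> R
}.

Definition M0n : weighted_fan :=
  WeightedFan
    [set sigma | exists2 C : marked_tree n,
       #|bounded_edges C| = (n - 3)%N & sigma = type_cone C]%classic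
    (fun=> 1).

(* phi_sigma, on the span of sigma: the common value at v of the linear forms
   agreeing with phi on sigma. *)
Definition linear_on (phi : Qn -> R) (sigma : set Qn) (v : Qn) : R :=
  xget 0 [set r | exists2 L : {linear Qn -> R^o},
     (forall x, sigma x -> L x = phi x) & r = L v]%classic.

(* For tau of codimension one in the pure fan Z, the facets of Z containing tau
   have tau as a codimension-one face. *)
Definition divisor_weight (phi : Qn -> R) (Z : weighted_fan) (tau : set Qn) : R :=
  let star := [set sigma | facets Z sigma /\ (tau `<=` sigma)]%classic in
  \sum_(sigma \in star)
     linear_on phi sigma (weight Z sigma *: primitive sigma tau)
  - linear_on phi tau
      (\sum_(sigma \in star) weight Z sigma *: primitive sigma tau).

Definition divisor (phi : Qn -> R) (Z : weighted_fan) : weighted_fan :=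
  WeightedFan
    [set tau | (exists2 sigma, facets Z sigma & codim1_face tau sigma)
               /\ divisor_weight phi Z tau != 0]%classic
    (divisor_weight phi Z).

Definition pair_avoiding (k : 'I_n) (S : {set 'I_n}) : bool :=
  (#|S| == 2%N) && (k \notin S).

Definition reduced_repr (k : 'I_n) (v : Qn) (l : {set 'I_n} -> R) : Prop :=
  [/\ v = \sum_(S | pair_avoiding k S) l S *: vI S,
      forall S, pair_avoiding k S -> 0 <= l S
    & exists2 S, pair_avoiding k S & l S = 0].

(* The reduced representation of v exists and is unique. *)
Definition fk (k : 'I_n) (v : Qn) : R :=
  xget 0 [set r | exists2 l, reduced_repr k v l
                 & r = \sum_(S | pair_avoiding k S) l S]%classic.

(* The divisor of f_k on M_{0,n} is 'C(n - 1, 2) times the k-th Psi-class, hence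
   the normalisation. *)
Definition psi_mul (k : 'I_n) (Z : weighted_fan) : weighted_fan :=
  let D := divisor (fk k) Z in
  WeightedFan (facets D) (fun tau => 'C(n.-1, 2)%:R^-1 * weight D tau).

(* Indices are repeated in s according to the exponents of the Psi-classes. *)
Definition psi_prod (s : seq 'I_n) : weighted_fan := foldr psi_mul M0n s.

End Qn.

(* Main.v *)
(* A cone of M_{0,n} is determined by the splits of its type, and splits can be
   added or removed freely subject to pairwise compatibility. By induction on the
   number of factors, the weight of a cone in Psi^k is

     prod_V g(V) / prod_i k_i!,    g(V) = K_V! if val V = K_V + 3, and 0 otherwise,

   where V runs over the vertices of the type and K_V is the sum of the k_i over the
   leaves i at V. On a cone, f_k is the sum over the pairs S avoiding k of the Gromov
   products of S at k, minus C(n-1,2) times the Gromov product of a fixed pair {i,j}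
   such that no split of the cone separates k from both i and j. Hence the weight of
   Psi_k . Z at tau is the sum of the weights of the facets which split off k from i
   and j. For a vertex with legs P, |P| = K_P + 4, and distinct legs e, f, g this sum
   is evaluated by

     sum K_A! K_{P-A}! = (K_P + 1)! / (k_e + 1),

   over the A with e in A, f, g not in A and |A| = K_A + 2. This is the hitting time
   theorem for a walk with steps 1 - k_x taken in random order; the same identity
   gives the balancing condition, with coefficient (K_P + 1)! / (k_e + 1) at v_e. *)
From HB Require Import structures.
Require Import Defs.
From mathcomp Require Import all_boot all_order all_algebra zify ring lra.
Set Implicit Arguments.
Unset Strict Implicit.
Unset Printing Implicit Defensive.
Import GRing.Theory Num.Theory.

(** * Ordered hitting times *)

(** The weight formula reproduces itself because of an index shift. Let k' be k with k_x raised by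
    one. A vertex P splits into two vertices of nonzero weight only if val P = K_P + 4, which is the
    weight condition on P for k' when P carries the leaf x. The numerator (K_P + 1)! is then the one
    required for k', and 1/(k_x + 1) completes the product of the k'_i! in the denominator. Two
    features of the definitions shape the rest. A cone is a bare subset of Q_n, so its splits must
    be recovered from it before a weight can be read off; functionals on four labels do this. And a
    linear function given on tau has a determined value only on the span of tau, so the divisor
    cannot be evaluated before the weighted sum of primitive vectors is known to lie there:
    balancing is part of the computation, not a corollary of it. Both halves of every split are
    kept, whence the even cardinalities and the factors 2. *)

Section HittingTime.
Variables (T : finType) (kappa : T -> nat).
Implicit Types (A B N : {set T}) (r : nat).

Definition ksum A := \sum_(x in A) kappa x.

(* The number of orderings of A along which the walk with steps 1 - kappa x
   reaches the level r at the last step, and not before. *)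
Definition hits A r := if A == set0 then r == 0 : nat else r * #|A|.-1`!.

Lemma ksum0 : ksum set0 = 0.
Proof. by rewrite /ksum big_set0. Qed.

Lemma ksumU1 x A : x \notin A -> ksum (x |: A) = kappa x + ksum A.
Proof. by move=> xA; rewrite /ksum big_setU1. Qed.

Lemma ksumD1 x A : x \in A -> ksum A = kappa x + ksum (A :\ x).
Proof. by move=> xA; rewrite /ksum (big_setD1 x). Qed.

Lemma ksumID A B : A \subset B -> ksum B = ksum A + ksum (B :\: A).
Proof. by move=> /setIidPr sAB; rewrite /ksum (big_setID A) sAB. Qed.

(** The orderings are sorted by their first element [x], whose step [1 - kappa x] leaves the walk
    [r.-1 + kappa x] below its target. *)
Lemma hits_first_step A r : 0 < r -> #|A| = ksum A + r ->
  hits A r = \sum_(x in A) hits (A :\ x) (r.-1 + kappa x).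
Proof.
move=> r0 cA; have A0 : 0 < #|A| by rewrite cA addn_gt0 r0 orbT.
have [m Em] : exists m, #|A| = m.+1 by exists #|A|.-1; rewrite prednK.
rewrite /hits -cards_eq0 Em /=.
case: m Em => [|m] Em.
  have /cards1P[x Ax] : #|A| == 1 by rewrite Em.
  rewrite Ax big_set1 setDv eqxx muln1.
  by move: cA; rewrite Em Ax /ksum big_set1; case: r r0 => //= r _; lia.
rewrite (eq_bigr (fun x => (r.-1 + kappa x) * m`!)); last first.
  move=> x xA; have cD : #|A :\ x| = m.+1.
    by move: Em; rewrite (cardsD1 x) xA => -[].
  by rewrite -cards_eq0 cD.
(* Summing [r.-1 + kappa x] over [A] gives [#|A| * r.-1 + ksum A], which is [r * #|A|.-1] because
   [ksum A = #|A| - r]. *)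
rewrite -big_distrl big_split /= sum_nat_const -/(ksum A) Em factS mulnA; congr (_ * _).
case: r r0 cA => // r _; rewrite Em => cA /=.
by move: (ksum A) cA => t cA; nia.
Qed.

(* Every ordering of N reaches the level r, since the walk moves up by at most
   one at each step and ends at #|N| - ksum N. *)
Lemma hitting_sum N r : ksum N + r <= #|N| ->
  \sum_(A : {set T} | (A \subset N) && (#|A| == ksum A + r))
     hits A r * (#|N| - #|A|)`! = #|N|`!.
Proof.
have level0 N' : \sum_(A : {set T} | (A \subset N') && (#|A| == ksum A + 0))
    hits A 0 * (#|N'| - #|A|)`! = #|N'|`!.
  rewrite (bigD1 set0) /=; last by rewrite sub0set cards0 ksum0.
  rewrite /hits eqxx mul1n cards0 subn0 big1 ?addn0 // => A /andP[_ /negPf->].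
  by rewrite mul0n.
move Em: #|N| => m; elim: m N r Em => [|m IH] N [|r] Em le_r;
  try by have := level0 N; rewrite Em.
  by move: le_r; rewrite addnS.
(* Both sides are sorted by the first element [x] of an ordering of [N]; the factorial of
   [#|N| - #|A|] orders what follows the hitting time. *)
transitivity (\sum_(x in N) m`!); last by rewrite sum_nat_const Em factS.
transitivity (\sum_(x in N) \sum_(A : {set T} | [&& A \subset N, #|A| == ksum A + r.+1 & x \in A])
    hits (A :\ x) (r + kappa x) * (m.+1 - #|A|)`!).
  rewrite (exchange_big_dep (fun A : {set T} => (A \subset N) && (#|A| == ksum A + r.+1))) /=; last first.
    by move=> x A _ /and3P[-> ->].
  apply: eq_bigr => A /andP[sAN cA].
  rewrite hits_first_step ?(eqP cA) // big_distrl /=.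
  apply: eq_bigl => x; rewrite sAN -(eqP cA) eqxx /=.
  by case xA: (x \in A); rewrite ?andbF ?(subsetP sAN).
apply: eq_bigr => x xN.
have Em' : #|N :\ x| = m by move: Em; rewrite (cardsD1 x) xN => -[].
rewrite -(IH (N :\ x) (r + kappa x)) //; last first.
  by move: le_r; rewrite (ksumD1 xN); lia.
rewrite (reindex_onto (fun B => x |: B) (fun A => A :\ x)) /=; last first.
  by move=> A /and3P[_ _ xA]; rewrite setD1K.
apply: eq_big => [B|B].
  rewrite setU11 andbT subsetD1 subUset sub1set xN /=.
  case xB: (x \in B); last first.
    rewrite setU1K ?xB // eqxx !andbT cardsU1 xB ksumU1 ?xB //.
    by congr (_ && _); apply/eqP/eqP; lia.
  rewrite andbF /=; apply/negP => /andP[_ /eqP E].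
  by move: xB; rewrite -E setD11.
move=> /andP[_ /eqP E]; have xB : x \notin B by rewrite -E setD11.
by rewrite E cardsU1 xB.
Qed.

(** The weight of the vertex formed by the legs [A] and one new bounded edge. That edge carries no
    exponent, so valence [ksum A + 3] means [#|A| = ksum A + 2]. *)
Definition branch_weight A := if #|A| == ksum A + 2 then (ksum A)`! else 0.

(* With f and g removed from P, this is the sum of [hitting_sum] at the level
   [kappa e + 1]. *)
Lemma splitting_sum (P : {set T}) (e f g : T) :
  e \in P -> f \in P -> g \in P -> e != f -> e != g -> f != g ->
  #|P| = ksum P + 4 ->
  (\sum_(A : {set T} | [&& A \subset P, e \in A, f \notin A & g \notin A])
      branch_weight A * branch_weight (P :\: A)) * (kappa e).+1 = (ksum P).+1`!.
Proof.
move=> eP fP gP ef eg fg cP.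
(* [A] will run over the sets [e |: B] with [B] inside [N]; leaving out three legs makes
   [#|N| = (ksum P).+1]. *)
pose N := P :\ e :\ f :\ g.
have eN : e \notin N by rewrite !inE eqxx !andbF.
have gPe : g \in P :\ e :\ f by rewrite !inE gP eq_sym fg eq_sym eg.
have fPe : f \in P :\ e by rewrite !inE fP eq_sym ef.
have cN : #|N| = (ksum P).+1.
  by move: cP; rewrite (cardsD1 e) eP (cardsD1 f) fPe (cardsD1 g) gPe -/N; lia.
have tN : ksum P = kappa e + (kappa f + (kappa g + ksum N)).
  by rewrite (ksumD1 eP) (ksumD1 fPe) (ksumD1 gPe).
rewrite -cN -(@hitting_sum N (kappa e).+1); last by rewrite cN; lia.
rewrite big_distrl /=.
rewrite (reindex_onto (fun B => e |: B) (fun A => A :\ e)) /=; last first.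
  by move=> A /and4P[_ eA _ _]; rewrite setD1K.
rewrite [RHS]big_mkcondr /=.
have sNP : N \subset P by do 2 apply: subset_trans (subsetDl _ _) _; apply: subsetDl.
apply: eq_big => [B|B].
  rewrite subUset sub1set eP setU11 !inE ![_ == e]eq_sym (negPf ef) (negPf eg) /=.
  rewrite !subsetD1; case eB: (e \in B) => /=.
    rewrite andbF /=; apply/negP => /andP[_ /eqP E].
    by move: eB; rewrite -E setD11.
  by rewrite setU1K ?eB // eqxx !andbT -andbA.
move=> /andP[/and4P[sBP _ fB gB] /eqP E]; have eB : e \notin B by rewrite -E setD11.
have cD := cardsID (e |: B) P; rewrite (setIidPr sBP) in cD.
have tD := ksumID sBP.
have B1 := cardsU1 e B; rewrite eB /= in B1; have tB := ksumU1 eB.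
rewrite /branch_weight.
have -> : (#|B| == ksum B + (kappa e).+1) = (#|e |: B| == ksum (e |: B) + 2).
  rewrite B1 tB; clear; apply/eqP/eqP; lia.
case: eqP => [c1|_]; last by rewrite !mul0n.
have c2 : #|P :\: (e |: B)| = ksum (P :\: (e |: B)) + 2.
  by move: cD tD c1 cP; clear; lia.
rewrite c2 eqxx.
rewrite /hits -cards_eq0; case: eqP => [b0|bn0].
  by move: c1; rewrite B1 tB b0; clear; lia.
(* The half [e |: B] supplies the factorial of [#|B|.-1] contained in [hits], and the other half
   that of [#|N| - #|B|]. *)
have -> : ksum (e |: B) = #|B|.-1 by move: c1 B1; clear; lia.
have -> : ksum (P :\: (e |: B)) = #|N| - #|B|.
  by move: cN tD c1 B1; clear; lia.
by rewrite mulnAC [_`! * _]mulnC.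
Qed.

End HittingTime.

(** * Split systems and their vertices *)

Section SplitSystems.
Variable T : finType.
Implicit Types (I J e f : {set T}) (G P Q A : {set {set T}}).

Lemma block_eq P e f x : trivIset P -> e \in P -> f \in P ->
  x \in e -> x \in f -> e = f.
Proof. by move=> tP eP fP xe xf; rewrite -(def_pblock tP eP xe) (def_pblock tP fP xf). Qed.

Lemma sub_block_eq P e f : trivIset P -> e \in P -> f \in P -> e != set0 ->
  e \subset f -> e = f.
Proof. by move=> tP eP fP /set0Pn[x xe] /subsetP/(_ x xe); exact: block_eq tP eP fP xe. Qed.

Definition compatible I J :=
  [|| I \subset J, I \subset ~: J, ~: I \subset J | ~: I \subset ~: J].

Lemma compatibleC I J : compatible I J = compatible J I.
Proof.
by rewrite /compatible -(setCS J I) (subsetC I J) (subCset I J) (setCS I J);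
  do !case: (_ \subset _).
Qed.

Lemma compatibleN I J : compatible (~: I) J = compatible I J.
Proof. by rewrite /compatible !setCK; do !case: (_ \subset _). Qed.

Definition split_system G :=
  [forall I in G, (~: I \in G) && (1 < #|I|)] &&
  [forall I in G, [forall J in G, compatible I J]].

Lemma split_systemP G :
  reflect [/\ forall I, I \in G -> ~: I \in G, forall I, I \in G -> 1 < #|I|
            & forall I J, I \in G -> J \in G -> compatible I J]
          (split_system G).
Proof.
apply: (iffP andP) => [[/forall_inP G1 /forall_inP G2]|[GC G2 Gc]].
  by split=> [I /G1/andP[]|I /G1/andP[]|I J /G2/forall_inP/[apply]].
split; apply/forall_inP=> I IG; first by rewrite GC // G2.
by apply/forall_inP=> J JG; apply: Gc.
Qed.

Definition add_split G I := I |: (~: I |: G).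

Definition insertable G I := (I \notin G) && split_system (add_split G I).

Lemma in_add_split G I J :
  (J \in add_split G I) = [|| J == I, J == ~: I | J \in G].
Proof. by rewrite !inE. Qed.

Lemma add_splitC G I : add_split G (~: I) = add_split G I.
Proof. by rewrite /add_split setCK setUCA. Qed.

Lemma insertableP G I : split_system G ->
  reflect [/\ I \notin G, 1 < #|I|, 1 < #|~: I|
            & forall J, J \in G -> compatible I J]
          (insertable G I).
Proof.
move=> /split_systemP[GC G2 Gc]; apply: (iffP andP) => [[IG]|[IG I2 IC2 Ic]].
  case/split_systemP=> _ A2 Ac; split=> //; try by apply: A2; rewrite in_add_split eqxx ?orbT.
  by move=> J JG; apply: Ac; rewrite in_add_split ?JG ?eqxx ?orbT.
split=> //; apply/split_systemP; split=> [J|J|J K].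
- rewrite !in_add_split => /or3P[/eqP->|/eqP->|/GC->]; rewrite ?setCK ?eqxx ?orbT //.
- by rewrite in_add_split => /or3P[/eqP->|/eqP->|/G2].
have self L : compatible L L by rewrite /compatible subxx.
have cI L : L \in G -> compatible L I by rewrite compatibleC; apply: Ic.
have nr L M : compatible L (~: M) = compatible L M.
  by rewrite compatibleC compatibleN compatibleC.
rewrite !in_add_split => /or3P[/eqP->|/eqP->|JG] /or3P[/eqP->|/eqP->|KG];
  rewrite ?compatibleN ?nr ?self //; by [apply: Ic | apply: cI | apply: Gc].
Qed.

Lemma insertableC G I : split_system G -> insertable G (~: I) = insertable G I.
Proof.
move=> sG; rewrite /insertable add_splitC; congr (~~ _ && _).
have /split_systemP[GC _ _] := sG.
by apply/idP/idP => /GC //; rewrite setCK.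
Qed.

Lemma split_system_neqC G I : split_system G -> I \in G -> I != ~: I.
Proof.
move=> /split_systemP[_ G2 _] /G2; apply: contraTneq => E.
suff -> : I = set0 by rewrite cards0.
by rewrite -[I]setIid {2}E setICr.
Qed.

Lemma del_split_system G I : split_system G ->
  split_system (G :\: [set I; ~: I]).
Proof.
move=> /split_systemP[GC G2 Gc]; apply/split_systemP; split=> [J|J|J K].
- rewrite !inE !negb_or => /andP[/andP[JI JnI] /GC->]; rewrite andbT.
  by rewrite (inj_eq (@setC_inj T)) JI -(inj_eq (@setC_inj T)) setCK JnI.
- by rewrite inE => /andP[_ /G2].
by rewrite !inE => /andP[_ JG] /andP[_ KG]; apply: Gc.
Qed.

Lemma add_del_split G I : split_system G -> I \in G ->
  add_split (G :\: [set I; ~: I]) I = G.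
Proof.
move=> /split_systemP[GC _ _] IG; apply/setP=> J; rewrite !inE.
by case: eqP => [->|_]; rewrite ?IG //=; case: eqP => [->|] //=; rewrite ?GC.
Qed.

Lemma card_add_split G I : split_system G -> insertable G I ->
  #|add_split G I| = #|G|.+2.
Proof.
move=> sG iI; have iC : insertable G (~: I) by rewrite insertableC.
case/andP: iI => IG sGI; case/andP: iC => ICG _.
rewrite /add_split !cardsU1 ICG !inE (negPf IG) orbF.
by rewrite (split_system_neqC sGI) // in_add_split eqxx.
Qed.

Lemma insertable_del G I : split_system G -> I \in G ->
  insertable (G :\: [set I; ~: I]) I.
Proof. by move=> sG IG; rewrite /insertable add_del_split // sG !inE eqxx. Qed.

(* A leg of a vertex is given by the set of labels behind it. *)
Definition leg G e := (e \in G) || (#|e| == 1).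

(* The vertices of the tree with splits G, as the partitions of the labels by
   the legs of the vertex. *)
Definition vertices G : {set {set {set T}}} :=
  [set P | [&& partition P setT, 2 < #|P|, [forall e in P, leg G e]
    & [forall J in G, [exists e in P, (J \subset e) || (~: J \subset e)]]]].

Lemma verticesP G P :
  reflect [/\ partition P setT, 2 < #|P|, forall e, e \in P -> leg G e
    & forall J, J \in G -> exists2 e, e \in P & (J \subset e) || (~: J \subset e)]
    (P \in vertices G).
Proof.
rewrite inE; apply: (iffP and4P) => -[pP P3 lP sP]; split=> //.
- exact/forall_inP.
- by move/forall_inP: sP => sP J /sP /exists_inP.
- exact/forall_inP.
by apply/forall_inP=> J /sP?; apply/exists_inP.
Qed.

(** For an edge with halves [I] and [~: I], these are the legs inside [I] at its endpoint on that
    side; the remaining leg there is [~: I]. [I] need not belong to [G], so the definition also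
    serves an edge that is about to be inserted. *)
Definition children G I : {set {set T}} :=
  [set e | maxset [pred e : {set T} | leg G e && (e \proper I)] e].

Lemma childrenP G I e :
  reflect [/\ leg G e, e \proper I
      & forall f, leg G f -> f \proper I -> e \subset f -> f = e]
    (e \in children G I).
Proof.
rewrite inE; apply: (iffP maxsetP) => [[/andP[le eI] m]|[le eI m]].
  by split=> // f lf fI; apply: m; rewrite /= lf.
by split=> [|f /andP[lf fI]]; [rewrite /= le | apply: m].
Qed.

Lemma sub_child G I e : leg G e -> e \proper I ->
  exists2 f, f \in children G I & e \subset f.
Proof.
move=> le eI; have [|f mf ef] := @maxset_exists _ [pred e : {set T} | leg G e && (e \proper I)] e.
  by rewrite /= le.
by exists f; rewrite ?inE.
Qed.

Section System.
Variable G : {set {set T}}.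
Hypothesis sG : split_system G.

Let GC I : I \in G -> ~: I \in G. Proof. by case/split_systemP: sG => h _ _; apply: h. Qed.
Let G2 I : I \in G -> 1 < #|I|. Proof. by case/split_systemP: sG => _ h _; apply: h. Qed.
Let Gc I J : I \in G -> J \in G -> compatible I J.
Proof. by case/split_systemP: sG => _ _ h; apply: h. Qed.

Lemma leg_neq0 e : leg G e -> e != set0.
Proof.
by rewrite -card_gt0 => /orP[/G2/ltnW|/eqP->].
Qed.

(** Compatibility also admits two sets that together cover all labels. Subsets of a proper subset
    [I] cannot do so, which leaves nesting or disjointness. *)
Lemma leg_laminar e f I : leg G e -> leg G f -> e \subset I -> f \subset I ->
  ~: I != set0 -> [|| e \subset f, f \subset e | [disjoint e & f]].
Proof.
move=> le lf eI fI I0; case/orP: le => [eG|/cards1P[x ->]]; last first.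
  by rewrite sub1set disjoints1; case: (x \in f); rewrite ?orbT.
case/orP: lf => [fG|/cards1P[x ->]]; last first.
  by rewrite sub1set disjoint_sym disjoints1; case: (x \in e); rewrite ?orbT.
have := Gc eG fG; rewrite /compatible -disjoints_subset setCS.
case/or4P=> [->|->|s|->]; rewrite ?orbT //.
case/negP: I0; rewrite -subset0; apply/subsetP=> x; rewrite !inE => xI.
case xe: (x \in e); first by rewrite (subsetP eI) in xI.
by rewrite (subsetP fI) // (subsetP s) // inE xe in xI.
Qed.

Section Children.
Variable I : {set T}.
Hypotheses (I2 : 1 < #|I|) (I0 : ~: I != set0).

Lemma cover_children : cover (children G I) = I.
Proof.
apply/setP=> x; apply/bigcupP/idP=> [[e /childrenP[_ /proper_sub/subsetP eI _]]|xI].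
  exact: eI.
have [||f fc] := @sub_child G I [set x]; first by rewrite /leg cards1 orbT.
  by rewrite properEcard sub1set xI cards1.
by rewrite sub1set; exists f.
Qed.

Lemma trivIset_children : trivIset (children G I).
Proof.
apply/trivIsetP=> e f /childrenP[le eI me] /childrenP[lf fI mf] ef.
have := leg_laminar le lf (proper_sub eI) (proper_sub fI) I0.
case/or3P=> // [/(me _ lf fI) E|/(mf _ le eI) E]; by rewrite E eqxx in ef.
Qed.

Lemma card_children : 1 < #|children G I|.
Proof.
rewrite ltnNge; apply/negP=> c1; have := cover_children.
have [c0|[e ce]] : children G I = set0 \/ exists e, children G I = [set e].
- move: c1; rewrite leq_eqVlt ltnS leqn0 cards_eq0 => /orP[/cards1P[e ->]|/eqP->].
    by right; exists e.
  by left.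
- by rewrite c0 /cover big_set0 => E; move: I2; rewrite -E cards0.
rewrite ce /cover big_set1 => E.
have /childrenP[_] : e \in children G I by rewrite ce inE.
by rewrite E properxx.
Qed.

Lemma set0_children : set0 \notin children G I.
Proof. by apply/negP=> /childrenP[/leg_neq0]; rewrite eqxx. Qed.

End Children.

Lemma partition_union A B I :
  cover A = I -> cover B = ~: I -> trivIset A -> trivIset B ->
  set0 \notin A -> set0 \notin B ->
  partition (A :|: B) setT /\ #|A :|: B| = #|A| + #|B|.
Proof.
move=> cA cB tA tB A0 B0.
have sub (C : {set {set T}}) K e : cover C = K -> e \in C -> e \subset K.
  by move=> <- eC; apply: bigcup_sup.
split; last first.
  rewrite cardsU; suff -> : A :&: B = set0 by rewrite cards0 subn0.
  apply/setP=> e; rewrite !inE; apply/negP=> /andP[eA eB].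
  have /set0Pn[x xe] : e != set0 by apply: contraNneq A0 => <-.
  have := subsetP (sub _ _ _ cB eB) x xe; rewrite inE.
  by rewrite (subsetP (sub _ _ _ cA eA)).
rewrite /partition inE (negPf A0) (negPf B0) andbT; apply/andP; split.
  by rewrite /cover bigcup_setU -/(cover A) -/(cover B) cA cB setUCr.
have dAB e f : e \in A -> f \in B -> [disjoint e & f].
  move=> eA fB; rewrite disjoints_subset.
  by rewrite (subset_trans (sub _ _ _ cA eA)) // subsetC (sub _ _ _ cB fB).
apply/trivIsetP=> e f; rewrite !inE => /orP[eA|eB] /orP[fA|fB] ef.
- by move/trivIsetP: tA => ->.
- exact: dAB.
- by rewrite disjoint_sym dAB.
- by move/trivIsetP: tB => ->.
Qed.

(** This is the vertex that the insertion of [I] pulls apart: contracting the new edge joins the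
    legs at its two endpoints. *)
Lemma split_vertex I : insertable G I ->
  children G I :|: children G (~: I) \in vertices G.
Proof.
case/(insertableP _ sG)=> IG I2 IC2 Ic.
have I0 : ~: I != set0 by rewrite -card_gt0 ltnW.
have J0 : ~: ~: I != set0 by rewrite setCK -card_gt0 ltnW.
have [pP cP] := partition_union (cover_children I2) (cover_children IC2)
  (trivIset_children I0) (trivIset_children J0) (set0_children _) (set0_children _).
apply/verticesP; split=> //.
- by rewrite cP; have := card_children I2; have := card_children IC2; lia.
- by move=> e; rewrite in_setU => /orP[]/childrenP[].
move=> J JG.
have neI K : K \in G -> K != I by move=> KG; apply: contraNneq IG => <-.
have neC K : K \in G -> K != ~: I.
  by move=> KG; apply: contraNneq IG => E; rewrite -[I]setCK -E GC.
have lG K : K \in G -> leg G K by rewrite /leg => ->.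
have ex (K L : {set T}) : K \in G -> K \subset L -> K != L ->
    exists2 e, e \in children G L & K \subset e.
  by move=> KG KL nKL; apply: sub_child; rewrite ?lG // properEneq nKL.
have := Ic J JG; rewrite compatibleC => /or4P[] s.
- by have [e ec Je] := ex _ _ JG s (neI _ JG); exists e; rewrite ?in_setU ?ec ?Je.
- by have [e ec Je] := ex _ _ JG s (neC _ JG); exists e; rewrite ?in_setU ?ec ?Je ?orbT.
- by have [e ec Je] := ex _ _ (GC JG) s (neI _ (GC JG)); exists e; rewrite ?in_setU ?ec ?Je ?orbT.
- by have [e ec Je] := ex _ _ (GC JG) s (neC _ (GC JG)); exists e; rewrite ?in_setU ?ec ?Je ?orbT.
Qed.

Lemma leg_vertex e : leg G e -> 1 < #|~: e| -> e |: children G (~: e) \in vertices G.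
Proof.
move=> le eC2; have e0 := leg_neq0 le.
have eC0 : ~: ~: e != set0 by rewrite setCK.
have c1 : cover [set e] = e by rewrite /cover big_set1.
have t1 : trivIset [set e] by apply/trivIsetP=> f g; rewrite !inE => /eqP-> /eqP->; rewrite eqxx.
have n1 : set0 \notin [set e] by rewrite inE eq_sym.
have [pP cP] := partition_union c1
  (cover_children eC2) t1 (trivIset_children eC0) n1 (set0_children _).
apply/verticesP; split=> //.
- by rewrite cP cards1; have := card_children eC2; lia.
- by move=> f; rewrite in_setU1 => /orP[/eqP->//|/childrenP[]].
move=> J JG; have sup K : K \in G -> K \subset ~: e ->
    ~: K = e \/ exists2 f, f \in children G (~: e) & K \subset f.
  move=> KG Ke; have [->|nKe] := eqVneq K (~: e); first by left; rewrite setCK.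
  by right; apply: sub_child; rewrite /leg ?KG // properEneq nKe.
have ok K : K \in G -> K \subset ~: e ->
    exists2 f, f \in e |: children G (~: e) & (K \subset f) || (~: K \subset f).
  move=> KG /(sup _ KG)[->|[f fc Kf]]; first by exists e; rewrite ?in_setU1 ?eqxx ?subxx ?orbT.
  by exists f; rewrite ?in_setU1 ?fc ?Kf ?orbT.
have ok' : ~: J \subset ~: e -> exists2 f, f \in e |: children G (~: e) &
    (J \subset f) || (~: J \subset f).
  by move=> /(ok _ (GC JG))[f fc]; rewrite setCK orbC; exists f.
have : compatible J e.
  case/orP: le => [eG|/cards1P[x ->]]; first exact: Gc.
  by rewrite /compatible !(subsetC _ [set x]) ?setCK !sub1set inE; case: (x \in J); rewrite ?orbT.
case/or4P=> s; last exact: ok'.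
- by exists e; rewrite ?in_setU1 ?eqxx ?s.
- exact: ok.
- by exists e; rewrite ?in_setU1 ?eqxx ?s ?orbT.
Qed.

Section Vertex.
Variable P : {set {set T}}.
Hypothesis PG : P \in vertices G.

Lemma vertex_trivIset : trivIset P.
Proof. by case/verticesP: PG => /and3P[]. Qed.

Lemma vertex_cover : cover P = setT.
Proof. by case/verticesP: PG => /and3P[/eqP]. Qed.

Lemma vertex_leg e : e \in P -> leg G e.
Proof. by case/verticesP: PG => _ _ h _; apply: h. Qed.

Lemma vertex_card : 2 < #|P|.
Proof. by case/verticesP: PG. Qed.

Lemma vertex_block x : exists2 e, e \in P & x \in e.
Proof. by apply/bigcupP; rewrite -/(cover P) vertex_cover. Qed.

Lemma vertex_leg_cmp f : leg G f -> exists2 e, e \in P & (f \subset e) || (~: f \subset e).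
Proof.
case/orP=> [fG|/cards1P[x ->]]; first by case/verticesP: PG => _ _ _; apply.
by have [e eP xe] := vertex_block x; exists e; rewrite // sub1set xe.
Qed.

Lemma vertex_other (e f : {set T}) : exists2 g, g \in P & (g != e) && (g != f).
Proof.
have : 0 < #|P :\ e :\ f|.
  have := vertex_card; rewrite (cardsD1 e) (cardsD1 f (P :\ e)).
  by case: (e \in P); case: (f \in _); rewrite /= ?add0n ?add1n ?ltnS //;
    do ?[by move/ltnW | by move/ltnW/ltnW].
by case/card_gt0P=> g; rewrite !inE => /and3P[gf ge gP]; exists g; rewrite ?ge.
Qed.

Lemma vertex_not_cover2 e f : e \in P -> f \in P -> ~~ (~: e \subset f).
Proof.
move=> eP fP; have [g gP /andP[ge gf]] := vertex_other e f.
have /set0Pn[x xg] := leg_neq0 (vertex_leg gP).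
apply/negP=> /subsetP/(_ x); rewrite inE => xf.
have xe : x \notin e by apply: contra ge => xe; rewrite (block_eq vertex_trivIset gP eP xg xe).
by case/eqP: gf; apply: block_eq vertex_trivIset gP fP xg (xf xe).
Qed.

End Vertex.

(** A leg is a directed edge and has only one tail. A leg [f] of [P] other than [e] lies in a leg
    [g] of [Q] other than [e], and [g] lies in a leg [h] of [P]; disjointness of blocks gives
    [f = h], hence [f = g]. *)
Lemma vertex_sub_block P Q e : P \in vertices G -> Q \in vertices G ->
  e \in P -> e \in Q -> P \subset Q.
Proof.
move=> PG QG eP eQ; apply/subsetP=> f fP.
have [->//|fe] := eqVneq f e.
have df (K : {set {set T}}) L : K \in vertices G -> e \in K -> L \in K -> L != e -> L \subset ~: e.
  move=> KG eK LK Le; rewrite -disjoints_subset.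
  by move/trivIsetP: (vertex_trivIset KG) => ->.
have sub (K L : {set {set T}}) h : K \in vertices G -> L \in vertices G -> e \in K -> e \in L ->
    h \in K -> h != e -> exists2 h', h' \in L & (h \subset h') && (h' != e).
  move=> KG LG eK eL hK he; have he' := df _ _ KG eK hK he.
  have [h' h'L /orP[s|s]] := vertex_leg_cmp LG (vertex_leg KG hK).
    exists h' => //; rewrite s; have /set0Pn[x xh] := leg_neq0 (vertex_leg KG hK).
    apply: contraTneq s => ->; apply/subsetPn; exists x => //.
    by have := subsetP he' x xh; rewrite inE.
  (* If [~: h] lies in [h'], then [h'] contains [e] and so equals [e], and [h] and [e] alone would
     cover all labels. *)
  have eh : e \subset h'.
    by rewrite subsetC in he'; apply: subset_trans s.
  have E := sub_block_eq (vertex_trivIset LG) eL h'L (leg_neq0 (vertex_leg KG eK)) eh.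
  by have := vertex_not_cover2 KG hK eK; rewrite E s.
have [g gQ /andP[fg ge]] := sub _ _ _ PG QG eP eQ fP fe.
have [h hP /andP[gh he]] := sub _ _ _ QG PG eQ eP gQ ge.
have E : f = h.
  apply: sub_block_eq (vertex_trivIset PG) fP hP (leg_neq0 (vertex_leg PG fP)) _.
  exact: subset_trans gh.
suff -> : f = g by [].
by apply/eqP; rewrite eqEsubset fg E.
Qed.

Lemma vertex_inj P Q e : P \in vertices G -> Q \in vertices G ->
  e \in P -> e \in Q -> P = Q.
Proof.
move=> PG QG eP eQ; apply/eqP.
by rewrite eqEsubset (vertex_sub_block PG QG eP eQ) (vertex_sub_block QG PG eQ eP).
Qed.

End System.
End SplitSystems.

(** * Inserting an edge at a vertex *)

Section VertexSplitting.
Variables (T : finType) (G : {set {set T}}).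
Hypothesis sG : split_system G.
Implicit Types (I J e f : {set T}) (P Q A : {set {set T}}).

Lemma setC_cover P A : P \in vertices G -> A \subset P -> ~: cover A = cover (P :\: A).
Proof.
move=> PG /subsetP sAP; apply/setP=> x; rewrite inE.
have [e eP xe] := vertex_block PG x.
have inA (B : {set {set T}}) : B \subset P -> (x \in cover B) = (e \in B).
  move=> /subsetP sBP; apply/bigcupP/idP=> [[f fB xf]|]; last by exists e.
  by rewrite (block_eq (vertex_trivIset PG) eP (sBP _ fB) xe xf).
by rewrite !inA ?subsetDl // ?inE ?eP ?andbT //; apply/subsetP.
Qed.

Lemma cover_not_sub P A e : P \in vertices G -> A \subset P -> 1 < #|A| -> e \in P ->
  ~~ (cover A \subset e).
Proof.
move=> PG /subsetP sAP /card_gt1P[f [g [fA gA fg]]] eP; apply/negP=> s.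
have E h : h \in A -> h = e.
  move=> hA; apply: sub_block_eq (vertex_trivIset PG) (sAP _ hA) eP _ _.
    by apply: (leg_neq0 sG); apply: (vertex_leg PG); apply: sAP.
  by apply: subset_trans s; apply: bigcup_sup hA.
by rewrite (E f) // (E g) // eqxx in fg.
Qed.

Lemma card_cover_gt1 P A : P \in vertices G -> A \subset P -> 1 < #|A| -> 1 < #|cover A|.
Proof.
move=> PG sAP A2; have [e eP _] := vertex_other PG set0 set0.
have /subsetPn[x xA _] := cover_not_sub PG sAP A2 eP.
have [f fP xf] := vertex_block PG x.
have /subsetPn[y yA yf] := cover_not_sub PG sAP A2 fP.
by apply/card_gt1P; exists x, y; split=> //; apply: contraNneq yf => <-.
Qed.

Section Cover.
Variables (P A : {set {set T}}).
Hypotheses (PG : P \in vertices G) (sAP : A \subset P).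
Hypotheses (A2 : 1 < #|A|) (PA2 : 1 < #|P :\: A|).

(** Each split of [G] has a half inside a single leg of [P], hence inside [cover A] or inside its
    complement. *)
Lemma insertable_cover : insertable G (cover A).
Proof.
have I2 := card_cover_gt1 PG sAP A2.
have IC2 := card_cover_gt1 PG (subsetDl P A) PA2.
apply/(insertableP _ sG); rewrite (setC_cover PG sAP); split=> // [|J JG].
  apply/negP=> IG; have [|e eP /orP[]] := vertex_leg_cmp PG (_ : leg G (cover A)).
  - by rewrite /leg IG.
  - by apply/negP; apply: cover_not_sub eP.
  by rewrite (setC_cover PG sAP); apply/negP; apply: cover_not_sub eP; rewrite ?subsetDl.
have [|e eP s] := vertex_leg_cmp PG (_ : leg G J); first by rewrite /leg JG.
have [eA|eA] := boolP (e \in A).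
  have eI : e \subset cover A by apply: bigcup_sup.
  by case/orP: s => /subset_trans/(_ eI) s; rewrite compatibleC /compatible s ?orbT.
have eI : e \subset ~: cover A.
  by rewrite (setC_cover PG sAP); apply: bigcup_sup; rewrite inE eA.
by case/orP: s => /subset_trans/(_ eI) s; rewrite compatibleC /compatible s ?orbT.
Qed.

Lemma children_cover : children G (cover A) = A.
Proof.
have inA e : e \in A -> e \in P by apply/subsetP.
have prop f : leg G f -> f \proper cover A -> exists2 e, e \in A & f \subset e.
  move=> lf fI; have [e eP /orP[s|s]] := vertex_leg_cmp PG lf.
    exists e => //; have /set0Pn[x xf] := leg_neq0 sG lf.
    have /bigcupP[g gA xg] := subsetP (proper_sub fI) x xf.
    by rewrite -(block_eq (vertex_trivIset PG) (inA g gA) eP xg (subsetP s _ xf)).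
  have /negP[] := cover_not_sub PG (subsetDl P A) PA2 eP.
  by rewrite -(setC_cover PG sAP) (subset_trans _ s) // setCS proper_sub.
have mem e : e \in A -> e \in children G (cover A).
  move=> eA; apply/childrenP; split=> [||f lf fI ef].
  - by apply: (vertex_leg PG); apply: inA.
  - have := cover_not_sub PG sAP A2 (inA e eA).
    by rewrite properE => ->; rewrite andbT; apply: bigcup_sup.
  have [g gA fg] := prop f lf fI; apply/eqP; rewrite eqEsubset ef andbT.
  rewrite (sub_block_eq (vertex_trivIset PG) (inA e eA) (inA g gA)) //.
    by apply: (leg_neq0 sG); apply: (vertex_leg PG); apply: inA.
  exact: subset_trans ef fg.
apply/eqP; rewrite eqEsubset; apply/andP; split; apply/subsetP=> // f /childrenP[lf fI mf].
have [g gA fg] := prop f lf fI; have /childrenP[lg gI _] := mem _ gA.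
by rewrite -(mf _ lg gI fg).
Qed.

End Cover.

(** Distinct vertices face each other: the leg of [P] towards [Q] and the leg of [Q] towards [P]
    cover all labels. Otherwise a chain of inclusions between legs of [P], [Q] and [P] again forces
    a common leg. *)
Lemma vertex_dichotomy P Q : P \in vertices G -> Q \in vertices G ->
  P = Q \/ exists p q, [/\ p \in P, q \in Q & ~: p \subset q].
Proof.
move=> PG QG; have [p pP _] := vertex_other PG set0 set0.
have [q qQ /orP[pq|pq]] := vertex_leg_cmp QG (vertex_leg PG pP); last by right; exists p, q.
have [p' p'P /orP[qp|qp]] := vertex_leg_cmp PG (vertex_leg QG qQ); last first.
  by right; exists p', q; rewrite subCset.
left; have E : p = p'.
  apply: sub_block_eq (vertex_trivIset PG) pP p'P (leg_neq0 sG (vertex_leg PG pP)) _.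
  exact: subset_trans pq qp.
have E' : p = q by apply/eqP; rewrite eqEsubset pq E qp.
by apply: (vertex_inj sG PG QG pP); rewrite E'.
Qed.

Lemma children_add I (K : {set T}) : insertable G I -> (K == I) || (K == ~: I) ->
  children (add_split G I) K = children G K.
Proof.
move=> iI KI; have [_ I2 IC2 _] := insertableP _ sG iI.
have E e : e \proper K -> leg (add_split G I) e = leg G e.
  move=> eK; rewrite /leg in_add_split.
  have ne L : ~: L != set0 -> ~: L \proper L = false.
    apply: contraNF => /proper_sub s; rewrite -subset0 -(setICr L) subsetI s.
    exact: subxx.
  have I0 : ~: I != set0 by rewrite -card_gt0 ltnW.
  have J0 : ~: ~: I != set0 by rewrite setCK -card_gt0 ltnW.
  case/orP: KI eK => /eqP-> eK.
    rewrite [e == I]negbTE /=; last by apply: contraTneq eK => ->; rewrite properxx.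
    by rewrite [e == _]negbTE //; apply: contraTneq eK => ->; rewrite ne.
  rewrite [e == ~: I]negbTE /=; last by apply: contraTneq eK => ->; rewrite properxx.
  by rewrite [e == _]negbTE //; apply: contraTneq eK => ->; rewrite -{1}[I]setCK ne.
apply/setP=> e; apply/childrenP/childrenP => -[le eK me].
  by split; rewrite -?E // => f lf fK; apply: me; rewrite ?E.
by split; rewrite ?E // => f lf fK; apply: me; rewrite -?E.
Qed.

Lemma vertices_add P A : P \in vertices G -> A \subset P ->
  1 < #|A| -> 1 < #|P :\: A| ->
  vertices (add_split G (cover A)) =
    (~: cover A |: A) |: ((cover A |: (P :\: A)) |: (vertices G :\ P)).
Proof.
move=> PG sAP A2 PA2; set I := cover A.
have iI : insertable G I := insertable_cover PG sAP A2 PA2.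
have [IG I2 IC2 Ic] := insertableP _ sG iI.
have sG' : split_system (add_split G I) by case/andP: iI.
have EC : ~: I = cover (P :\: A) := setC_cover PG sAP.
have cI : children G I = A := children_cover PG sAP A2 PA2.
have cIC : children G (~: I) = P :\: A.
  by rewrite EC (children_cover PG) ?subsetDl // setDDr setDv set0U (setIidPr sAP).
have V1 : ~: I |: A \in vertices (add_split G I).
  have := @leg_vertex _ _ sG' (~: I); rewrite setCK children_add ?eqxx // cI.
  by apply; rewrite // /leg in_add_split eqxx orbT.
have V2 : I |: (P :\: A) \in vertices (add_split G I).
  rewrite -cIC -(children_add iI) ?eqxx ?orbT //.
  by apply: leg_vertex; rewrite // /leg in_add_split eqxx.
apply/eqP; rewrite eqEsubset; apply/andP; split; last first.
  rewrite !subUset !sub1set V1 V2 /=; apply/subsetP=> Q; rewrite in_setD1 => /andP[QP QG].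
  have [E|[p [q [pP qQ s]]]] := vertex_dichotomy PG QG; first by rewrite E eqxx in QP.
  case/verticesP: (QG) => pQ Q3 lQ cQ; apply/verticesP; split=> // [e /lQ|J].
    by rewrite /leg in_add_split => /orP[->|->]; rewrite ?orbT.
  (* The leg [p] towards [Q] belongs to one of the two groups of legs, so [q] contains the whole
     half formed by the other group. *)
  have sI : (I \subset q) || (~: I \subset q).
    have [pA|pA] := boolP (p \in A).
      by apply/orP; right; apply: subset_trans s; rewrite setCS; apply: bigcup_sup.
    apply/orP; left; apply: subset_trans s; rewrite subsetC EC.
    by apply: bigcup_sup; rewrite inE pA.
  rewrite in_add_split => /or3P[/eqP->|/eqP->|]; [| |exact: cQ];
    by exists q; rewrite // setCK orbC.
apply/subsetP=> Q QG'; rewrite !in_setU1 in_setD1.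
have [Q1|nQ1] := boolP (~: I \in Q).
  by rewrite [Q](vertex_inj sG' QG' V1 Q1) ?eqxx // setU11.
have [Q2|nQ2] := boolP (I \in Q).
  by rewrite [Q](vertex_inj sG' QG' V2 Q2) ?eqxx ?orbT // setU11.
apply/orP; right; apply/orP; right; apply/andP; split.
  (* [P] itself disappears, since neither half of the new split lies in one of its legs. *)
  apply: contraTneq QG' => ->; apply/negP => PG'.
  have [|e eP /orP[]] := vertex_leg_cmp PG' (_ : leg (add_split G I) I).
  - by rewrite /leg in_add_split eqxx.
  - by apply/negP; apply: cover_not_sub eP.
  by rewrite EC; apply/negP; apply: cover_not_sub eP; rewrite ?subsetDl.
case/verticesP: QG' => pQ Q3 lQ cQ; apply/verticesP; split=> // [e eQ|J JG].
  case/orP: (lQ _ eQ) => [|e1]; last by rewrite /leg e1 orbT.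
  rewrite in_add_split => /or3P[/eqP E|/eqP E|eG].
  - by rewrite -E eQ in nQ2.
  - by rewrite -E eQ in nQ1.
  by rewrite /leg eG.
by apply: cQ; rewrite in_add_split JG !orbT.
Qed.

Lemma insertable_not_leg I : insertable G I -> ~~ leg G I.
Proof. by case/(insertableP _ sG)=> /negPf IG I2 _ _; rewrite /leg IG /=; case: eqP I2 => // ->. Qed.

Section BigVertices.
Variables (P A : {set {set T}}).
Hypotheses (PG : P \in vertices G) (sAP : A \subset P).
Hypotheses (A2 : 1 < #|A|) (PA2 : 1 < #|P :\: A|).

Let iI := insertable_cover PG sAP A2 PA2.
Let iIC : insertable G (~: cover A). Proof. by rewrite insertableC ?iI. Qed.

Lemma setC_cover_notin : ~: cover A \notin A.
Proof.
by apply: contra (insertable_not_leg iIC) => /(subsetP sAP)/(vertex_leg PG).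
Qed.

Lemma cover_notin : cover A \notin P :\: A.
Proof.
by apply: contra (insertable_not_leg iI); rewrite inE => /andP[_ /(vertex_leg PG)].
Qed.

(** Stated for any commutative monoid, as it serves both the product of the vertex weights and the
    sum of the valences. *)
Lemma big_vertices_add R (idx : R) (op : Monoid.com_law idx) (F : {set {set T}} -> R) :
  \big[op/idx]_(Q in vertices (add_split G (cover A))) F Q =
  op (F (~: cover A |: A))
    (op (F (cover A |: (P :\: A))) (\big[op/idx]_(Q in vertices G :\ P) F Q)).
Proof.
rewrite (vertices_add PG sAP A2 PA2) !big_setU1 //.
  rewrite in_setD1 negb_and; apply/orP; right.
  apply: contra (insertable_not_leg iI) => V; apply: (vertex_leg V); exact: setU11.
rewrite in_setU1 negb_or in_setD1 negb_and; apply/andP; split; last first.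
  apply/orP; right; apply: contra (insertable_not_leg iIC) => V.
  by apply: (vertex_leg V); exact: setU11.
apply/eqP=> E; have : cover A \in ~: cover A |: A by rewrite E setU11.
rewrite in_setU1 => /orP[/eqP E'|/(subsetP sAP) cA].
  have /andP[_ s'] := iI; have := split_system_neqC s' (_ : cover A \in _).
  by rewrite in_add_split eqxx -E' => /(_ isT); rewrite eqxx.
by have := vertex_leg PG cA; rewrite (negPf (insertable_not_leg iI)).
Qed.

End BigVertices.

(** To insert an edge is to choose a vertex and a group of at least two of its legs that leaves at
    least two others. The inverse recovers the vertex as the union of the children of both
    halves. *)
Lemma big_insertable R (idx : R) (op : Monoid.com_law idx) (F : {set T} -> R) :
  \big[op/idx]_(I | insertable G I) F I =
  \big[op/idx]_(P in vertices G)
    \big[op/idx]_(A : {set {set T}} | [&& A \subset P, 1 < #|A| & 1 < #|P :\: A|]) F (cover A).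
Proof.
rewrite pair_big_dep /=.
rewrite (reindex_onto (fun p : {set {set T}} * {set {set T}} => cover p.2)
  (fun I => (children G I :|: children G (~: I), children G I))) /=; last first.
  move=> I /(insertableP _ sG)[_ I2 IC2 _].
  by rewrite cover_children // -card_gt0 ltnW.
apply: eq_bigl => -[P A] /=.
apply/andP/and4P=> [[iI /eqP[EP EA]]|[PG sAP A2 PA2]].
  have [_ I2 IC2 _] := insertableP _ sG iI.
  have I0 : ~: cover A != set0 by rewrite -card_gt0 ltnW.
  have J0 : ~: ~: cover A != set0 by rewrite setCK -card_gt0 ltnW.
  have [_ cP] := partition_union (cover_children G I2) (cover_children G IC2)
    (trivIset_children sG I0) (trivIset_children sG J0)
    (set0_children sG _) (set0_children sG _).
  have sAP : A \subset P by rewrite -EP -{1}EA subsetUl.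
  split=> //.
  - by rewrite -EP; apply: split_vertex.
  - by rewrite -EA; apply: card_children.
  by rewrite EP EA in cP; rewrite cardsD (setIidPr sAP) cP addKn card_children.
have cA := children_cover PG sAP A2 PA2; split; first exact: insertable_cover PA2.
rewrite (setC_cover PG sAP) (children_cover PG _ PA2) ?subsetDl ?setDDr ?setDv ?set0U
  ?(setIidPr sAP) //.
rewrite cA xpair_eqE eqxx andbT; apply/eqP/setP=> e; rewrite !inE.
by case: (boolP (e \in A)) => // /(subsetP sAP)->.
Qed.

End VertexSplitting.

(** * Weights of split systems *)

Section Weights.
Variable T : finType.
Implicit Types (I J e f : {set T}) (G P Q A : {set {set T}}) (k : T -> nat).

(** A leaf edge carries the exponent of its label and a bounded edge carries 0, so
    [ksum (leg_weight k) P] is the sum of the exponents at [P]. *)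
Definition leg_weight k e := \sum_(i | e == [set i]) k i.

Lemma leg_weight1 k i : leg_weight k [set i] = k i.
Proof. by rewrite /leg_weight (big_pred1 i) // => j; rewrite (inj_eq set1_inj) eq_sym. Qed.

Lemma leg_weight_gt1 k e : 1 < #|e| -> leg_weight k e = 0.
Proof.
by move=> e2; rewrite /leg_weight big_pred0 // => i; apply: contraTF e2 => /eqP->; rewrite cards1.
Qed.

Definition vertex_weight k P :=
  if #|P| == ksum (leg_weight k) P + 3 then (ksum (leg_weight k) P)`! else 0.

Definition system_weight k G := \prod_(P in vertices G) vertex_weight k P.

Definition coweight k G P := \prod_(Q in vertices G :\ P) vertex_weight k Q.

Lemma weight_coweight k G P : P \in vertices G ->
  system_weight k G = vertex_weight k P * coweight k G P.
Proof. by move=> PG; rewrite /system_weight (big_setD1 P). Qed.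

Definition splitting_weight k P A :=
  branch_weight (leg_weight k) A * branch_weight (leg_weight k) (P :\: A).

Lemma splitting_weightC k P A : A \subset P ->
  splitting_weight k P (P :\: A) = splitting_weight k P A.
Proof.
by move=> sAP; rewrite /splitting_weight setDDr setDv set0U (setIidPr sAP) mulnC.
Qed.

Lemma branch_weight_neq0 k A : branch_weight (leg_weight k) A != 0 -> 1 < #|A|.
Proof. by rewrite /branch_weight; case: ifP => [/eqP->|//]; rewrite addn2. Qed.

Lemma splitting_weight_neq0 k P A : A \subset P -> splitting_weight k P A != 0 ->
  #|P| = ksum (leg_weight k) P + 4.
Proof.
move=> sAP; rewrite /splitting_weight /branch_weight; case: ifP => [/eqP c1|//].
case: ifP => [/eqP c2 _|_]; last by rewrite muln0.
have := cardsID A P; rewrite (setIidPr sAP) (ksumID (leg_weight k) sAP).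
by rewrite c1 c2 => <-; rewrite addnACA.
Qed.

Section System.
Variable G : {set {set T}}.
Hypothesis sG : split_system G.

Lemma system_weight_add k P A : P \in vertices G -> A \subset P ->
  1 < #|A| -> 1 < #|P :\: A| ->
  system_weight k (add_split G (cover A)) = splitting_weight k P A * coweight k G P.
Proof.
move=> PG sAP A2 PA2; rewrite /system_weight (big_vertices_add sG PG) //= -/(coweight k G P).
have bw e (B : {set {set T}}) : 1 < #|e| -> e \notin B -> vertex_weight k (e |: B) = branch_weight (leg_weight k) B.
  move=> e2 eB; rewrite /vertex_weight /branch_weight ksumU1 // leg_weight_gt1 // cardsU1 eB.
  by rewrite add0n add1n [_ + 3]addnS eqSS.
have IC2 : 1 < #|~: cover A| by rewrite (setC_cover PG sAP) (card_cover_gt1 sG PG) ?subsetDl.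
by rewrite !bw ?(setC_cover_notin sG PG) ?(cover_notin sG PG) ?(card_cover_gt1 sG PG) // mulnA.
Qed.

Lemma sum_system_weight_add k (F : {set T} -> nat) :
  \sum_(I | insertable G I) system_weight k (add_split G I) * F I =
  \sum_(P in vertices G) coweight k G P *
    \sum_(A : {set {set T}} | A \subset P) splitting_weight k P A * F (cover A).
Proof.
rewrite (big_insertable sG); apply: eq_bigr => P PG; rewrite big_distrr /=.
rewrite big_mkcond [RHS]big_mkcond; apply: eq_bigr => A _.
case: (boolP (A \subset P)) => //= sAP; case: ifP => [/andP[A2 PA2]|A2].
  by rewrite (system_weight_add _ PG) // mulnCA mulnA.
rewrite /splitting_weight; have [->|/branch_weight_neq0 A2'] := eqVneq (branch_weight (leg_weight k) A) 0.
  by rewrite !mul0n muln0.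
have [->|/branch_weight_neq0 PA2'] := eqVneq (branch_weight (leg_weight k) (P :\: A)) 0.
  by rewrite muln0 !mul0n muln0.
by rewrite A2' PA2' in A2.
Qed.

(** This is [vertex_weight] of [P] after one exponent at [P] is raised by one: the total and the
    required valence both grow by one. *)
Definition defect_weight k P :=
  if #|P| == ksum (leg_weight k) P + 4 then (ksum (leg_weight k) P).+1`! else 0.

Lemma sum_splitting_weight k P e f g :
  e \in P -> f \in P -> g \in P -> e != f -> e != g -> f != g ->
  (\sum_(A : {set {set T}} | A \subset P)
     splitting_weight k P A * [&& e \in A, f \notin A & g \notin A]) * (leg_weight k e).+1 =
  defect_weight k P.
Proof.
move=> eP fP gP ef eg fg; rewrite /defect_weight; case: ifP => [/eqP cP|cP].
  rewrite -(splitting_sum eP fP gP ef eg fg cP); congr (_ * _).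
  rewrite big_mkcondr; apply: eq_bigr => A _.
  by case: ifP; rewrite ?muln1 ?muln0.
rewrite big1 ?mul0n // => A sAP; have [->|/(splitting_weight_neq0 sAP) E] := eqVneq (splitting_weight k P A) 0.
  by rewrite mul0n.
by rewrite E eqxx in cP.
Qed.

Lemma mem_cover_vertex P A x e : P \in vertices G -> A \subset P -> e \in P -> x \in e ->
  (x \in cover A) = (e \in A).
Proof.
move=> PG /subsetP sAP eP xe; apply/bigcupP/idP=> [[f fA xf]|]; last by exists e.
by rewrite (block_eq (vertex_trivIset PG) eP (sAP f fA) xe xf).
Qed.

Hypothesis T3 : 2 < #|T|.

Lemma cardsC1_gt1 (x : T) : 1 < #|~: [set x]|.
Proof. by have := cardsC [set x]; rewrite cards1 addnC addn1 => E; rewrite -ltnS E. Qed.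

Lemma leaf_vertex (x : T) : exists2 P, P \in vertices G & [set x] \in P.
Proof.
exists ([set x] |: children G (~: [set x])); last exact: setU11.
by apply: leg_vertex; rewrite ?cardsC1_gt1 // /leg cards1 orbT.
Qed.

(* No split of G separates x from both i and j; hence the Gromov product of i and j
   at x vanishes on the cone of G. *)
Definition apart (x i j : T) := [/\ i != x, j != x, i != j &
  forall J, J \in G -> x \notin J -> i \in J -> j \notin J].

(** Labels from two further legs at the vertex of the leaf [x] will do: a half avoiding [x] cannot
    contain both, since it or its complement lies in one leg of that vertex. *)
Lemma exists_apart (x : T) : exists i j, apart x i j.
Proof.
have [P PG xP] := leaf_vertex x.
have [e eP /andP[ex _]] := vertex_other PG [set x] [set x].
have [f fP /andP[fx fe]] := vertex_other PG [set x] e.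
have /set0Pn[i ie] := leg_neq0 sG (vertex_leg PG eP).
have /set0Pn[j jf] := leg_neq0 sG (vertex_leg PG fP).
have tP := vertex_trivIset PG.
have nx y h : h \in P -> h != [set x] -> y \in h -> y != x.
  move=> hP hx yh; apply: contraNneq hx => E; rewrite E in yh.
  by apply/eqP; apply: (block_eq tP hP xP yh); rewrite inE.
exists i, j; split; [exact: nx ie | exact: nx jf | |move=> J JG xJ iJ].
  by apply: contraNneq fe => E; rewrite -E in jf; rewrite (block_eq tP fP eP jf ie).
apply/negP=> jJ; have [|h hP /orP[s|s]] := vertex_leg_cmp PG (_ : leg G J).
- by rewrite /leg JG.
- have hi := block_eq tP eP hP ie (subsetP s _ iJ).
  have hj := block_eq tP fP hP jf (subsetP s _ jJ).
  by rewrite hj hi eqxx in fe.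
have xh : x \in h by apply: (subsetP s); rewrite inE.
have E : h = [set x] by apply: (block_eq tP hP xP xh); rewrite inE.
have /split_systemP[GC G2 _] := sG; have := subset_leq_card s.
by rewrite E cards1 leqNgt G2 // GC.
Qed.

(* At the vertices not adjacent to the leaf x no splitting separates x from
   both i and j. *)
Lemma sum_system_weight_apart k k' x i j : apart x i j ->
  (forall y, k' y = k y + (y == x)) ->
  (\sum_(I | insertable G I)
     system_weight k (add_split G I) * [&& x \in I, i \notin I & j \notin I]) * (k x).+1 =
  system_weight k' G.
Proof.
move=> [ix jx ij sep] Ek; rewrite sum_system_weight_add.
have [P0 P0G xP0] := leaf_vertex x.
have lw e : e != [set x] -> leg_weight k' e = leg_weight k e.
  move=> ex; apply: eq_bigr => y /eqP ey; rewrite Ek [y == x]negbTE ?addn0 //.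
  by apply: contraNneq ex => <-; apply/eqP.
rewrite (bigD1 P0) //= [X in _ + X]big1 => [|P /andP[PG PP0]]; last first.
  rewrite big1 ?muln0 // => A sAP.
  have [e eP xe] := vertex_block PG x; have [f fP jf] := vertex_block PG i.
  have [g gP jg] := vertex_block PG j.
  rewrite !(mem_cover_vertex PG sAP eP xe, mem_cover_vertex PG sAP fP jf, mem_cover_vertex PG sAP gP jg).
  suff /orP[/eqP->|/eqP->] : (e == f) || (e == g).
  - by case: (f \in A); rewrite /= ?muln0.
  - by case: (g \in A); rewrite /= ?andbF ?muln0.
  (* At a vertex other than [P0] the label [x] sits behind a bounded edge [e], and [~: e] cannot
     contain both [i] and [j]. One of them thus shares the leg of [x], and no union of legs
     separates the two. *)
  have eG : e \in G.
    case/orP: (vertex_leg PG eP) => // /cards1P[y ey].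
    by case/negP: PP0; apply/eqP; apply: (vertex_inj sG PG P0G eP); rewrite ey; move: xe; rewrite ey inE => /eqP<-.
  have [ie|ie] := boolP (i \in e).
    by rewrite (block_eq (vertex_trivIset PG) eP fP ie jf) eqxx.
  have /split_systemP[GC _ _] := sG; move: (sep (~: e) (GC e eG)).
  rewrite !inE xe ie => /(_ isT isT).
  by rewrite negbK => je; rewrite (block_eq (vertex_trivIset PG) eP gP je jg) eqxx orbT.
rewrite addn0 -mulnA.
have [f fP jf] := vertex_block P0G i; have [g gP jg] := vertex_block P0G j.
have xx : x \in [set x] by rewrite inE.
have fx : [set x] != f by apply: contraNneq ix => E; move: jf; rewrite -E inE.
have gx : [set x] != g by apply: contraNneq jx => E; move: jg; rewrite -E inE.
have tP := vertex_trivIset P0G.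
have fg : f != g.
  apply: contraTneq isT => E; rewrite -E in jg; apply/negP=> _.
  have nxf : x \notin f by apply: contra fx => xf; rewrite (block_eq tP xP0 fP xx xf).
  case/orP: (vertex_leg P0G fP) => [fG|/cards1P[y fy]].
    by have := sep _ fG nxf jf; rewrite jg.
  by move: jf jg ij; rewrite fy !inE => /eqP-> /eqP->; rewrite eqxx.
have -> : (\sum_(A : {set {set T}} | A \subset P0) splitting_weight k P0 A *
    [&& x \in cover A, i \notin cover A & j \notin cover A]) * (k x).+1 = defect_weight k P0.
  rewrite -(sum_splitting_weight k xP0 fP gP fx gx fg) leg_weight1; congr (_ * _).
  apply: eq_bigr => A sAP.
  by rewrite (mem_cover_vertex P0G sAP xP0 xx) (mem_cover_vertex P0G sAP fP jf) (mem_cover_vertex P0G sAP gP jg).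
(* The defect weight of [P0] for [k] is its vertex weight for [k'], and no other vertex sees the
   change at [x]. *)
rewrite (weight_coweight k' P0G) mulnC; congr (_ * _).
  rewrite /defect_weight /vertex_weight !(ksumD1 _ xP0) !leg_weight1 Ek eqxx addn1.
  have -> : ksum (leg_weight k') (P0 :\ [set x]) = ksum (leg_weight k) (P0 :\ [set x]).
    by apply: eq_bigr => e /setD1P[ex _]; apply: lw.
  by rewrite addSn addnS [in RHS]addSn.
apply: eq_bigr => Q /setD1P[QP QG]; rewrite /vertex_weight.
suff -> : ksum (leg_weight k) Q = ksum (leg_weight k') Q by [].
apply: eq_bigr => e eQ; rewrite lw //; apply: contraNneq QP => E.
by apply/eqP; apply: (vertex_inj sG QG P0G eQ); rewrite E.
Qed.

End System.
End Weights.

(** * The balancing condition *)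

Section Balancing.
Variables (T : finType) (G : {set {set T}}).
Hypothesis sG : split_system G.
Implicit Types (I J e f : {set T}) (P Q A : {set {set T}}) (k : T -> nat).
  Local Open Scope ring_scope.

Definition leg_coef (R : numFieldType) k P e : R :=
  (defect_weight k P)%:R / (leg_weight k e).+1%:R.

(** A third leg [g] may fall on either side. Passing to [P :\: A] moves it out of [A], so each of
    the sums of [sum_splitting_weight], with distinguished leg [e] or [f], occurs twice. *)
Lemma sum_splitting_sep (R : numFieldType) k P e f : P \in vertices G ->
  e \in P -> f \in P -> e != f ->
  (\sum_(A : {set {set T}} | A \subset P)
     splitting_weight k P A * ((e \in A) (+) (f \in A)))%N%:R =
  2%:R * (leg_coef R k P e + leg_coef R k P f).
Proof.
move=> PG eP fP ef; have [g gP /andP[ge gf]] := vertex_other PG e f.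
rewrite ![g == _]eq_sym in ge gf.
pose S e f g := (\sum_(A : {set {set T}} | A \subset P)
     splitting_weight k P A * [&& e \in A, f \notin A & g \notin A])%N.
have SE e' f' : e' \in P -> f' \in P -> e' != f' -> e' != g -> f' != g ->
    (S e' f' g)%:R = leg_coef R k P e'.
  move=> e'P f'P ef' eg fg; rewrite /leg_coef -(sum_splitting_weight k e'P f'P gP ef' eg fg).
  by rewrite natrM mulfK // pnatr_eq0.
have SC e' f' : e' \in P -> f' \in P ->
    (\sum_(A : {set {set T}} | A \subset P)
       splitting_weight k P A * [&& e' \in A, f' \notin A & g \in A])%N = S f' e' g.
  move=> e'P f'P; rewrite /S (reindex_onto (fun A => P :\: A) (fun A => P :\: A)) /=; last first.
    by move=> A sAP; rewrite setDDr setDv set0U (setIidPr sAP).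
  apply: eq_big => [A|A /andP[_ /eqP EA]].
    rewrite subsetDl /=; apply/eqP/idP => [<-|sAP]; first exact: subsetDl.
    by rewrite setDDr setDv set0U (setIidPr sAP).
  have sAP : A \subset P by rewrite -EA subsetDl.
  rewrite splitting_weightC // !inE e'P f'P gP !andbT negbK.
  by case: (_ \in A); case: (_ \in A); case: (_ \in A).
transitivity (((S e f g + S f e g) * 2)%N%:R : R); last first.
  by rewrite natrM natrD !SE // 1?eq_sym // mulrC.
congr (_%:R : R); rewrite muln2 -addnn -{1}(SC f e) // -{1}(SC e f) // /S -!big_split /=.
apply: eq_bigr => A _; rewrite -!mulnDr; congr (_ * _)%N.
by case: (_ \in A); case: (_ \in A); case: (_ \in A).
Qed.

(** This is the coordinate at [[set p; q]] of an identity between the vectors of inserted splits and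
    those of the legs. The factor 2 appears because both halves of each inserted split are
    summed. *)
Lemma balancing (R : numFieldType) k (p q : T) :
  \sum_(I | insertable G I)
     (system_weight k (add_split G I))%:R * ((p \in I) (+) (q \in I))%:R =
  \sum_(P in vertices G) \sum_(e in P)
     2%:R * (coweight k G P)%:R * leg_coef R k P e * ((p \in e) (+) (q \in e))%:R.
Proof.
transitivity ((\sum_(I | insertable G I)
    system_weight k (add_split G I) * ((p \in I) (+) (q \in I)))%N%:R : R).
  by rewrite natr_sum; apply: eq_bigr => I _; rewrite natrM.
rewrite (sum_system_weight_add sG) natr_sum; apply: eq_bigr => P PG; rewrite natrM.
have [e eP pe] := vertex_block PG p; have [f fP qf] := vertex_block PG q.
have tP := vertex_trivIset PG.
rewrite (eq_bigr (fun A => splitting_weight k P A * ((e \in A) (+) (f \in A)))%N); last first.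
  by move=> A sAP; rewrite (mem_cover_vertex PG sAP eP pe) (mem_cover_vertex PG sAP fP qf).
have memE x h h' : h \in P -> x \in h -> h' \in P -> (x \in h') = (h' == h).
  by move=> hP xh h'P; apply/idP/eqP => [xh'|->//]; apply: block_eq tP h'P hP xh' xh.
have E e' : e' \in P -> (p \in e') (+) (q \in e') = (e' == e) (+) (e' == f).
  by move=> e'P; rewrite (memE p e) // (memE q f).
(* If [p] and [q] lie behind the same leg, both sides vanish; otherwise [e] and [f] are the only
   legs that separate them. *)
have [ef|ef] := eqVneq e f.
  rewrite -ef [X in _ * X%:R]big1 ?mulr0; last by move=> A _; rewrite addbb muln0.
  by rewrite big1 // => e' e'P; rewrite E // -ef addbb mulr0.
rewrite (sum_splitting_sep R k PG) //.
rewrite (bigD1 e) //= (bigD1 f) //=; last by rewrite fP eq_sym.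
rewrite big1 ?addr0 => [|e' /andP[/andP[e'P /negPf ne] /negPf nf]]; last first.
  by rewrite E // ne nf mulr0.
by rewrite !E // !eqxx (negPf ef) eq_sym (negPf ef) /= !mulr1; ring.
Qed.

End Balancing.

(** * The dimension count *)

Section Counting.
Variable T : finType.
Hypothesis T3 : 2 < #|T|.
Implicit Types (I : {set T}) (G P : {set {set T}}) (k : T -> nat).

Definition singletons : {set {set T}} := [set [set x] | x in T].

Lemma card_singletons : #|singletons| = #|T|.
Proof. by rewrite card_imset //; exact: set1_inj. Qed.

Lemma vertices_set0 : vertices (set0 : {set {set T}}) = [set singletons].
Proof.
have s0 : split_system (set0 : {set {set T}}).
  by apply/split_systemP; split=> [I|I|I J]; rewrite inE.
have [x0 _] : exists x0 : T, x0 \in T by apply/card_gt0P; apply: leq_trans T3.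
have V : singletons \in vertices set0.
  apply/verticesP; rewrite card_singletons; split=> // [|e /imsetP[x _ ->]|J]; last first.
  - by rewrite inE.
  - by rewrite /leg cards1 orbT.
  apply/and3P; split.
  - apply/eqP/setP=> x; rewrite inE; apply/bigcupP; exists [set x]; last by rewrite inE.
    exact: imset_f.
  - apply/trivIsetP=> _ _ /imsetP[x _ ->] /imsetP[y _ ->] xy.
    by rewrite disjoints1 inE; apply: contra xy => /eqP->.
  - by apply/imsetP=> -[x _ /esym/eqP]; rewrite -cards_eq0 cards1.
apply/eqP; rewrite eqEsubset sub1set V andbT; apply/subsetP=> Q QV; rewrite inE.
have [e eQ xe] := vertex_block QV x0.
have := vertex_leg QV eQ; rewrite /leg inE => /cards1P[y ey].
apply/eqP; apply: (vertex_inj s0 QV V eQ).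
by rewrite ey; apply: imset_f.
Qed.

(** An inserted edge replaces a vertex with [a + b] legs by two with [a.+1] and [b.+1] legs, which
    lowers the sum by one while [G] gains two halves. In particular [#|G| = (#|T| - 3).*2] forces
    all vertices to be trivalent. *)
Lemma sum_valence G : split_system G ->
  (\sum_(P in vertices G) (#|P| - 3)).*2 + #|G| = (#|T| - 3).*2.
Proof.
move Em: #|G| => m; elim/ltn_ind: m G Em => m IH G Em sG.
have [G0|[I IG]] := set_0Vmem G.
  by rewrite -Em G0 cards0 addn0 vertices_set0 big_set1 card_singletons.
pose G' := G :\: [set I; ~: I].
have sG' : split_system G' by apply: del_split_system.
have iI : insertable G' I by apply: insertable_del.
have EG : add_split G' I = G by apply: add_del_split.
have cG : m = #|G'|.+2 by rewrite -Em -EG card_add_split.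
rewrite -(IH #|G'| _ G') ?cG //.
have [_ I2 IC2 _] := insertableP _ sG' iI.
have cI := cover_children G' I2; have cIC := cover_children G' IC2.
have I0 : ~: I != set0 by rewrite -card_gt0 ltnW.
have J0 : ~: ~: I != set0 by rewrite setCK -card_gt0 ltnW.
have [_ cP] := partition_union cI cIC (trivIset_children sG' I0) (trivIset_children sG' J0)
  (set0_children sG' _) (set0_children sG' _).
have PV := split_vertex sG' iI; set P := _ :|: _ in cP PV.
have sAP : children G' I \subset P := subsetUl _ _.
have A2 := card_children G' I2; have B2 := card_children G' IC2.
have cPA : #|P :\: children G' I| = #|children G' (~: I)|.
  by rewrite cardsD (setIidPr sAP) cP addKn.
have PA2 : 1 < #|P :\: children G' I| by rewrite cPA.
rewrite -{1}EG -{1}cI (big_vertices_add sG' PV sAP A2 PA2) /=.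
rewrite !cardsU1 (setC_cover_notin sG' PV sAP A2 PA2) (cover_notin sG' PV sAP A2 PA2) cPA.
rewrite (big_setD1 P PV) /= cP.
move: A2 B2 (\sum_(Q in _) _) #|G'|; move: #|children G' I| #|children G' (~: I)|.
by move=> a b A2 B2 s g; move: A2 B2; clear; lia.
Qed.

End Counting.

(** * Trees and split systems *)

Section TreeSplits.
Variables (n : nat) (C : marked_tree n).
Implicit Types (x y z a b : vertex C).

Lemma adj_neq x y : adj x y -> x != y.
Proof. by apply: contraTneq => ->; rewrite adj_irr. Qed.

Lemma set2C x y : [set x; y] = [set y; x].
Proof. exact: setUC. Qed.

Lemma set2_eq x y a b : x != y -> [set a; b] = [set x; y] -> (a = x /\ b = y) \/ (a = y /\ b = x).
Proof.
move=> xy E; have aE : a \in [set x; y] by rewrite -E !inE eqxx.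
have bE : b \in [set x; y] by rewrite -E !inE eqxx orbT.
have xE : x \in [set a; b] by rewrite E !inE eqxx.
have yE : y \in [set a; b] by rewrite E !inE eqxx orbT.
move: aE bE xE yE; rewrite !inE => /orP[]/eqP-> /orP[]/eqP->; auto.
- by rewrite !orbb => _ /eqP yx; rewrite yx eqxx in xy.
- by rewrite !orbb => /eqP yx; rewrite yx eqxx in xy.
Qed.

Definition branch x y := [set z | connect (delete_edge x y) x z].

Lemma branch_refl x y : x \in branch x y.
Proof. by rewrite inE connect0. Qed.

Lemma branch_step x y a b : a \in branch x y -> adj a b -> [set a; b] != [set x; y] ->
  b \in branch x y.
Proof.
rewrite !inE => xa ab ne; apply: connect_trans xa (connect1 _).
by rewrite /delete_edge ab.
Qed.

Lemma branch_edge x y a b : adj a b -> [set a; b] != [set x; y] ->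
  (a \in branch x y) = (b \in branch x y).
Proof.
move=> ab ne; apply/idP/idP => h; first exact: branch_step h ab ne.
by apply: branch_step h _ _; rewrite 1?adj_sym // set2C.
Qed.

Lemma branch_ind x y (Q : pred (vertex C)) : Q x ->
  (forall a b, a \in branch x y -> adj a b -> [set a; b] != [set x; y] -> Q a -> Q b) ->
  forall z, z \in branch x y -> Q z.
Proof.
move=> Qx step z; rewrite inE => /connectP[p pP ->] {z}.
suff : (last x p \in branch x y) && Q (last x p) by case/andP.
elim/last_ind: p pP => [|p b IH]; first by rewrite branch_refl Qx.
rewrite rcons_path last_rcons => /andP[/IH/andP[aB Qa] /andP[ab ne]].
by rewrite (branch_step aB ab ne) (step _ _ aB ab ne).
Qed.

(** A simple path from [x] to [y] avoiding their edge would close up with it to a cycle, of length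
    at least 3 because a single step would be that edge. *)
Lemma notin_branch x y : adj x y -> y \notin branch x y.
Proof.
move=> xy; rewrite inE; apply/connectP=> -[p0 pP0 /esym Ey].
case/shortenP: pP0 Ey => p pP up _ E.
have sub : subrel (delete_edge x y) (@adj n C) by move=> a b /andP[].
have cyc : ucycle (@adj n C) (x :: p).
  by rewrite /ucycle up andbT /= rcons_path (sub_path sub pP) E adj_sym.
case: p E pP {up} cyc => [|a [|b p]] E pP cyc.
- by rewrite /= in E; rewrite E adj_irr in xy.
- by move: pP; rewrite /= in E; rewrite E /= /delete_edge eqxx andbF.
- by have := adj_acyclic cyc.
Qed.

Lemma branch_setC x y : adj x y -> branch y x = ~: branch x y.
Proof.
move=> xy; have nx : x \notin branch y x by apply: notin_branch; rewrite adj_sym.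
apply/setP=> z; rewrite in_setC.
have [zB|zB] := boolP (z \in branch x y).
  apply/negbTE; move: z zB; apply: branch_ind => // a b _ ab ne.
  by rewrite (@branch_edge y x a b) // [[set y; x]]set2C.
have: (z \in branch x y) || (z \in branch y x); last by rewrite (negPf zB).
have /connectP[p pP ->] := adj_connected x z.
elim/last_ind: p pP => [|p b IH]; first by rewrite branch_refl.
rewrite rcons_path last_rcons => /andP[/IH Qa ab].
have [E|ne] := eqVneq [set last x p; b] [set x; y].
  by case: (set2_eq (adj_neq xy) E) => -[_ ->]; rewrite branch_refl ?orbT.
by rewrite -(branch_edge ab ne) -(@branch_edge y x _ _ ab) // [[set y; x]]set2C.
Qed.

(** A walk inside [branch x y] never uses the edge between [a] and [b], which lie outside, so it
    stays on the side of [x]. *)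
Lemma sub_branch x y a b : adj a b -> a \notin branch x y -> b \notin branch x y ->
  x \in branch a b -> branch x y \subset branch a b.
Proof.
move=> ab aN bN xB; apply/subsetP; apply: branch_ind => // c d cB cd ne.
move=> /branch_step; apply=> //; apply: contra aN => /eqP E.
by case: (set2_eq (adj_neq ab) E) => -[Ec Ed]; rewrite -?Ec // -Ed -(branch_edge cd ne).
Qed.

Lemma edge_neq x y z : z != y -> [set x; z] != [set x; y].
Proof.
move=> zy; apply/eqP=> E.
have : z \in [set x; y] by rewrite -E !inE eqxx orbT.
have : y \in [set x; z] by rewrite E !inE eqxx orbT.
rewrite !inE [y == z]eq_sym (negPf zy) !orbF => /eqP yx /eqP zx.
by rewrite zx yx eqxx in zy.
Qed.

Lemma adj_branch_sub x y z : adj x y -> adj x z -> z != y -> branch z x \subset branch x y.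
Proof.
move=> xy xz zy; have zx : adj z x by rewrite adj_sym.
have nx := notin_branch zx.
apply: sub_branch => //.
- rewrite -(branch_edge xy) // [[set z; x]]set2C; apply: edge_neq; by rewrite eq_sym.
- by rewrite -(branch_edge xz) ?branch_refl // edge_neq.
Qed.

Lemma leaf_in_branch x y : adj x y -> exists i, leaf C i \in branch x y.
Proof.
move Em: #|branch x y| => m; elim/ltn_ind: m x y Em => m IH x y Em xy.
have [/codomP[i ->]|xl] := boolP (x \in codom (leaf C)); first by exists i; rewrite branch_refl.
have : 1 < #|[set w | adj x w]|.
  rewrite ltn_neqAle eq_sym -/(valence _ x) leaf_valence xl card_gt0.
  by apply/set0Pn; exists y; rewrite inE.
rewrite (cardsD1 y) inE xy ltnS => /card_gt0P[z]; rewrite !inE => /andP[zy xz].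
have s := adj_branch_sub xy xz zy; have zx : adj z x by rewrite adj_sym.
have [||i] := IH #|branch z x| _ z x (erefl _); rewrite // -?Em.
  apply: proper_card; rewrite properE s; apply/subsetPn.
  by exists x; [apply: branch_refl | apply: notin_branch].
by exists i; apply: (subsetP s).
Qed.

Lemma in_side x y i : (i \in side x y) = (leaf C i \in branch x y).
Proof. by rewrite !inE. Qed.

Lemma side_setC x y : adj x y -> side y x = ~: side x y.
Proof. by move=> xy; apply/setP=> i; rewrite in_setC !in_side branch_setC // in_setC. Qed.

Lemma sub_side x y a b : branch x y \subset branch a b -> side x y \subset side a b.
Proof. by move=> /subsetP s; apply/subsetP=> i; rewrite !in_side => /s. Qed.

Lemma other_neighbours x y : adj x y -> x \notin codom (leaf C) ->
  exists z1 z2, [/\ adj x z1, adj x z2, z1 != y, z2 != y & z1 != z2].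
Proof.
move=> xy xl; have : 2 < #|[set w | adj x w]|.
  rewrite ltn_neqAle eq_sym -/(valence _ x) no_2valent ltn_neqAle eq_sym leaf_valence xl card_gt0.
  by apply/set0Pn; exists y; rewrite inE.
rewrite (cardsD1 y) inE xy ltnS => /card_gt1P[z1 [z2 [h1 h2 h]]].
by exists z1, z2; move: h1 h2; rewrite !inE => /andP[-> ->] /andP[-> ->].
Qed.

Lemma branches_disjoint x z1 z2 : adj x z1 -> adj x z2 -> z1 != z2 ->
  [disjoint branch z1 x & branch z2 x].
Proof.
move=> h1 h2 z12; rewrite disjoints_subset -(@branch_setC z2 x); first exact: adj_branch_sub.
by rewrite adj_sym.
Qed.

Lemma card_side x y : adj x y -> x \notin codom (leaf C) -> 1 < #|side x y|.
Proof.
move=> xy xl; have [z1 [z2 [h1 h2 y1 y2 z12]]] := other_neighbours xy xl.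
have [|i iB] := @leaf_in_branch z1 x; first by rewrite adj_sym.
have [|j jB] := @leaf_in_branch z2 x; first by rewrite adj_sym.
apply/card_gt1P; exists i, j; rewrite !in_side.
rewrite (subsetP (adj_branch_sub xy h1 y1) _ iB) (subsetP (adj_branch_sub xy h2 y2) _ jB).
split=> //; apply: contraTneq iB => ->.
by rewrite (disjointFl (branches_disjoint h1 h2 z12) jB).
Qed.

Lemma side_compatible x y a b : adj x y -> adj a b -> compatible (side x y) (side a b).
Proof.
move=> xy ab; have [E|ne] := eqVneq [set a; b] [set x; y].
  case: (set2_eq (adj_neq xy) E) => -[-> ->]; rewrite /compatible ?subxx //.
  by rewrite (side_setC xy) subxx ?orbT.
wlog aN : x y xy ne / a \notin branch x y.
  move=> H; have [aB|] := boolP (a \in branch x y); last exact: H.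
  rewrite -compatibleN -side_setC //; apply: H; first by rewrite adj_sym.
    by rewrite [[set y; x]]set2C.
  by rewrite branch_setC // in_setC negbK.
have bN : b \notin branch x y by rewrite -(branch_edge ab ne).
have [xB|] := boolP (x \in branch a b).
  by rewrite /compatible sub_side // sub_branch.
have ba : adj b a by rewrite adj_sym.
rewrite -in_setC -branch_setC // => xB.
by rewrite /compatible -(side_setC ab) [X in _ || (X || _)]sub_side ?orbT // sub_branch.
Qed.

(** As [y] is not 2-valent, it has a neighbour [z] other than [x] and not on the way to [b]; a leaf
    behind [z] lies in [branch a b] but not in [branch x y]. *)
Lemma side_proper x y a b : adj x y -> adj a b -> y \notin codom (leaf C) ->
  [set a; b] != [set x; y] -> branch x y \subset branch a b -> side x y != side a b.
Proof.
move=> xy ab yl ne s; have yx : adj y x by rewrite adj_sym.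
have [z1 [z2 [h1 h2 y1 y2 z12]]] := other_neighbours yx yl.
have xB : x \in branch a b by rewrite (subsetP s) ?branch_refl.
have yB : y \in branch a b by rewrite -(branch_edge xy) // eq_sym.
have [z [yz zx bN]] : exists z, [/\ adj y z, z != x & b \notin branch z y].
  have [b1|b1] := boolP (b \in branch z1 y); last by exists z1.
  exists z2; split=> //.
  by rewrite (disjointFr (branches_disjoint h1 h2 z12) b1).
have zy : adj z y by rewrite adj_sym.
have nB := notin_branch ab.
have nez : [set a; b] != [set z; y].
  apply/eqP=> E; case: (set2_eq (adj_neq zy) E) => -[Ea Eb].
    by rewrite -Eb (negPf nB) in yB.
  by rewrite Eb branch_refl in bN.
have aN : a \notin branch z y by rewrite (branch_edge ab).
have sz : branch z y \subset branch a b.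
  apply: sub_branch => //; by rewrite (branch_edge zy) // eq_sym.
have [i iB] := leaf_in_branch zy.
apply/eqP=> /setP/(_ i); rewrite !in_side (subsetP sz) // => iB'.
by have := subsetP (adj_branch_sub yx yz zx) _ iB; rewrite branch_setC // in_setC iB'.
Qed.

Lemma side_inj x y a b : bounded_edge x y -> bounded_edge a b ->
  side x y = side a b -> x = a /\ y = b.
Proof.
move=> /and3P[xy xl yl] /and3P[ab al bl] E.
have yx : adj y x by rewrite adj_sym.
have ba : adj b a by rewrite adj_sym.
have nself (I : {set 'I_n}) : 1 < #|I| -> ~~ (I \subset ~: I).
  move=> I2; apply/negP=> s; have : I \subset I :&: ~: I by rewrite subsetI subxx.
  by rewrite setICr subset0 => /eqP I0; rewrite I0 cards0 in I2.
have [E2|ne] := eqVneq [set a; b] [set x; y].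
  case: (set2_eq (adj_neq xy) E2) => -[Ea Eb]; first by rewrite Ea Eb.
  have := nself _ (card_side xy xl).
  by rewrite {1}E Ea Eb side_setC // subxx.
have [aB|aN] := boolP (a \in branch x y); last first.
  have bN : b \notin branch x y by rewrite -(branch_edge ab ne).
  have [xB|] := boolP (x \in branch a b).
    by have := side_proper xy ab yl ne (sub_branch ab aN bN xB); rewrite E eqxx.
  rewrite -in_setC -branch_setC // => xB.
  have := sub_side (sub_branch ba bN aN xB).
  by rewrite (side_setC ab) -E (negPf (nself _ (card_side xy xl))).
have bB : b \in branch x y by rewrite -(branch_edge ab ne).
have aN : a \notin branch y x by rewrite branch_setC // in_setC negbK.
have bN : b \notin branch y x by rewrite branch_setC // in_setC negbK.
have [yB|] := boolP (y \in branch a b).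
  have := sub_side (sub_branch ab aN bN yB).
  by rewrite -E (side_setC yx) (negPf (nself _ (card_side yx yl))).
rewrite -in_setC -branch_setC // => yB.
have := sub_branch ba bN aN yB; rewrite (branch_setC xy) (branch_setC ab) setCS => s.
by have := side_proper ab xy bl _ s; rewrite E eqxx eq_sym => /(_ ne).
Qed.

Lemma splitsP I : reflect (exists x y, bounded_edge x y /\ I = side x y) (I \in splits C).
Proof.
rewrite inE; apply: (iffP existsP) => [[x /existsP[y /andP[xy /eqP->]]]|[x [y [xy ->]]]].
  by exists x, y.
by exists x; apply/existsP; exists y; rewrite xy /=.
Qed.

Lemma splits_system : split_system (splits C).
Proof.
apply/split_systemP; split=> [I|I|I J].
- case/splitsP=> x [y [/and3P[xy xl yl] ->]]; apply/splitsP; exists y, x.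
  by rewrite (side_setC xy) /bounded_edge adj_sym; split=> //; apply/and3P.
- by case/splitsP=> x [y [/and3P[xy xl yl] ->]]; apply: card_side.
case/splitsP=> x [y [/and3P[xy xl yl] ->]] /splitsP[a [b [/and3P[ab al bl] ->]]].
exact: side_compatible.
Qed.

(** [side] is injective on directed bounded edges, and each edge has two directions. *)
Lemma card_splits : #|splits C| = #|bounded_edges C|.*2.
Proof.
pose D := [set p : vertex C * vertex C | bounded_edge p.1 p.2].
have -> : splits C = [set side p.1 p.2 | p in D].
  apply/setP=> I; apply/splitsP/imsetP => [[x [y [xy ->]]]|[[x y]]].
    by exists (x, y); rewrite ?inE.
  by rewrite inE /= => xy ->; exists x, y.
rewrite card_in_imset; last first.
  move=> [x y] [a b]; rewrite !inE /= => xy ab /(side_inj xy ab)[-> ->] //.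
have memD p : p \in D -> [set p.1; p.2] \in bounded_edges C.
  by rewrite !inE => pD; apply/existsP; exists p.1; apply/existsP; exists p.2; rewrite pD /=.
rewrite -sum1_card (partition_big (fun p => [set p.1; p.2]) (mem (bounded_edges C))) //=.
rewrite -muln2 -sum_nat_const; apply: eq_bigr => e.
rewrite inE => /existsP[x /existsP[y /andP[xy /eqP->]]].
have nxy : x != y by apply: adj_neq; case/and3P: xy.
rewrite sum1_card -(_ : #|[set (x, y); (y, x)]| = 2); last first.
  by rewrite cards2 xpair_eqE (negPf nxy).
apply: eq_card => -[a b]; rewrite [LHS]unfold_in /= !inE /= !xpair_eqE.
apply/andP/orP => [[_ /eqP/(set2_eq nxy)[][-> ->]]|[]/andP[/eqP-> /eqP->]]; rewrite ?eqxx; auto.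
by rewrite set2C; split=> //; move: xy; rewrite /bounded_edge adj_sym => /and3P[-> -> ->].
Qed.

End TreeSplits.

(** * Realizing a split system by a tree *)

Section ClusterTree.
Variables (n : nat) (G : {set {set 'I_n}}) (r : 'I_n).
Hypotheses (n3 : 2 < n) (sG : split_system G).
Implicit Types (I J K L : {set 'I_n}).

(* The tree is rooted at the leaf r, and a vertex is represented by the set of
   labels below it, the leaf r itself by the set of all labels. *)
Definition cluster I := [|| I == setT, I == ~: [set r] | leg G I && (r \notin I)].

Definition covers I J := [&& cluster I, cluster J, J \proper I &
  [forall K, ~~ [&& cluster K, J \proper K & K \proper I]]].

Lemma card_top : #|~: [set r]| = n.-1.
Proof. by rewrite cardsC1 card_ord. Qed.

Lemma cluster_neq0 I : cluster I -> I != set0.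
Proof.
rewrite -card_gt0; case/or3P=> [/eqP->|/eqP->|/andP[/(leg_neq0 sG)]].
- by rewrite cardsT card_ord; apply: leq_trans n3.
- by rewrite card_top -ltnS prednK; [apply: ltnW | apply: leq_trans n3].
by rewrite -card_gt0.
Qed.

Lemma cluster_top I : cluster I -> I != setT -> I \subset ~: [set r].
Proof.
case/or3P=> [->//|/eqP->//|/andP[_ rI] _].
by rewrite subsetC sub1set inE.
Qed.

Lemma cluster_laminar I J : cluster I -> cluster J ->
  [|| I \subset J, J \subset I | [disjoint I & J]].
Proof.
move=> cI cJ; have [->|IT] := eqVneq I setT; first by rewrite subsetT orbT.
have [->|JT] := eqVneq J setT; first by rewrite subsetT.
have sI := cluster_top cI IT; have sJ := cluster_top cJ JT.
have [->|It] := eqVneq I (~: [set r]); first by rewrite sJ orbT.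
have [->|Jt] := eqVneq J (~: [set r]); first by rewrite sI.
move: cI cJ; rewrite /cluster (negPf IT) (negPf JT) (negPf It) (negPf Jt) /=.
move=> /andP[lI _] /andP[lJ _]; apply: (leg_laminar sG lI lJ sI sJ).
by rewrite setCK -card_gt0 cards1.
Qed.

Lemma cluster_chain I J K : cluster I -> cluster J -> cluster K ->
  K \subset I -> K \subset J -> (I \subset J) || (J \subset I).
Proof.
move=> cI cJ cK KI KJ; have := cluster_laminar cI cJ; rewrite orbA.
case/orP=> // /disjoint_setI0 E; have /set0Pn[x xK] := cluster_neq0 cK.
have : x \in I :&: J by rewrite inE (subsetP KI) ?(subsetP KJ).
by rewrite E inE.
Qed.

Lemma coversP I J : reflect [/\ cluster I, cluster J, J \proper I &
    forall K, cluster K -> J \proper K -> K \subset I -> K = I] (covers I J).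
Proof.
apply: (iffP and4P) => -[cI cJ JI h]; split=> //.
  move=> K cK JK KI; apply: contraTeq isT => nKI.
  by move/forallP: h => /(_ K); rewrite cK JK properEneq nKI KI.
apply/forallP=> K; apply/and3P=> -[cK JK]; rewrite properEneq => /andP[nKI KI].
by rewrite (h K cK JK KI) eqxx in nKI.
Qed.

Lemma covers_uniq I I' J : covers I J -> covers I' J -> I = I'.
Proof.
move=> /coversP[cI cJ JI m] /coversP[cI' _ JI' m'].
have /orP[s|s] := cluster_chain cI cI' cJ (proper_sub JI) (proper_sub JI').
  exact: m'.
by apply/esym; apply: m.
Qed.

Lemma covers_exists J K : cluster J -> cluster K -> J \proper K ->
  exists2 I, covers I J & I \subset K.
Proof.
move=> cJ cK JK; have [|I /minsetP[/andP[cI JI] m] IK] :=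
  @minset_exists _ [pred K : {set 'I_n} | cluster K && (J \proper K)] K.
  by rewrite /= cK.
exists I => //; apply/coversP; split=> // L cL JL LI; apply: m => //.
by rewrite /= cL.
Qed.

Lemma cluster1 (i : 'I_n) : i != r -> cluster [set i].
Proof. by move=> ir; rewrite /cluster /leg cards1 inE [r == i]eq_sym ir !orbT. Qed.

Lemma clusterT : cluster setT. Proof. by rewrite /cluster eqxx. Qed.

Lemma cluster_topE : cluster (~: [set r]). Proof. by rewrite /cluster eqxx orbT. Qed.

Definition node := {I : {set 'I_n} | cluster I}.

Implicit Types (u v w : node).

Definition node_adj : rel node :=
  fun u v => covers (val u) (val v) || covers (val v) (val u).

Lemma node_adj_sym : symmetric node_adj.
Proof. by move=> u v; rewrite /node_adj orbC. Qed.

Lemma covers_proper I J : covers I J -> J \proper I.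
Proof. by case/coversP. Qed.

Lemma node_adj_irr : irreflexive node_adj.
Proof. by move=> u; rewrite /node_adj orbb; apply/negP=> /covers_proper; rewrite properxx. Qed.

Lemma parent u : val u != setT -> exists2 v : node, covers (val v) (val u) & val u \proper val v.
Proof.
move=> uT; have [|I cI _] := covers_exists (valP u) clusterT; first by rewrite properEneq uT subsetT.
have cl : cluster I by case/coversP: cI.
by exists (exist _ I cl); rewrite ?(covers_proper cI).
Qed.

Lemma connect_root u : connect node_adj u (exist _ setT clusterT).
Proof.
move Em: (n - #|val u|) => m; elim/ltn_ind: m u Em => m IH u Em.
have [uT|uT] := eqVneq (val u) setT.
  by rewrite (_ : u = exist _ setT clusterT) ?connect0 //; apply: val_inj.
have [v vu /proper_card lt] := parent uT.
apply: connect_trans (IH _ _ v (erefl _)); first by apply: connect1; rewrite /node_adj vu orbT.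
have := max_card (mem (val v)); rewrite card_ord -Em => le.
by apply: ltn_sub2l => //; apply: leq_trans le.
Qed.

Lemma node_connected u v : connect node_adj u v.
Proof.
apply: connect_trans (connect_root u) _.
by rewrite (sym_connect_sym node_adj_sym) connect_root.
Qed.

(** In a cycle, a node with the fewest labels has both neighbours above it, and both would be its
    unique parent. *)
Lemma node_acyclic (p : seq node) : ucycle node_adj p -> size p < 3.
Proof.
move=> cp; rewrite ltnNge; apply/negP=> p3.
case: p p3 cp => // u0 p0 p3 cp; have u0p : u0 \in u0 :: p0 by rewrite inE eqxx.
case: (arg_minnP (fun u : node => #|val u|) u0p) => u up umin.
case/rot_to: up => i p' Ep.
have cp' : ucycle node_adj (u :: p') by rewrite -Ep rot_ucycle.
have p'3 : 2 < size (u :: p') by rewrite -Ep size_rot.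
have umin' v : v \in p' -> #|val u| <= #|val v|.
  move=> vp; have vp0 : v \in u0 :: p0 by rewrite -(mem_rot i) Ep inE vp orbT.
  exact: umin.
have par v : v \in p' -> node_adj u v -> covers (val v) (val u).
  move=> /umin' le /orP[/covers_proper/proper_card lt|//].
  by rewrite ltnNge le in lt.
case: p' cp' p'3 umin' par {Ep} => // v p'.
case/lastP: p' => // p' w /andP[cyc un] _ _ par.
move: cyc; rewrite /= rcons_path last_rcons => /and3P[uv _ wu].
have wp : w \in v :: rcons p' w by rewrite inE mem_rcons inE eqxx orbT.
have cv := par v (mem_head _ _) uv.
have cw := par w wp; rewrite node_adj_sym in cw; have {}cw := cw wu.
have E : v = w by apply: val_inj; apply: covers_uniq cv cw.
by move: un; rewrite /= E mem_rcons inE eqxx /= andbF.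
Qed.

Definition node_leaf (i : 'I_n) : node :=
  insubd (exist _ setT clusterT : node) (if i == r then setT else [set i]).

Lemma node_leafE i : val (node_leaf i) = if i == r then setT else [set i].
Proof.
rewrite insubdK // -topredE /=; case: eqP => [_|/eqP]; [exact: clusterT | exact: cluster1].
Qed.

Lemma set1_neqT (i : 'I_n) : [set i] != setT.
Proof.
apply: contraTneq n3 => /(congr1 (fun A : {set 'I_n} => #|A|)).
by rewrite cards1 cardsT card_ord => <-.
Qed.

Lemma node_leaf_inj : injective node_leaf.
Proof.
move=> i j /(congr1 val); rewrite !node_leafE.
case: eqP => [->|_]; case: eqP => [->|_] // E.
- by have := set1_neqT j; rewrite -E eqxx.
- by have := set1_neqT i; rewrite E eqxx.
exact: set1_inj.
Qed.

Lemma node_leafP u : reflect (val u = setT \/ exists2 i, i != r & val u = [set i])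
  (u \in codom node_leaf).
Proof.
apply: (iffP codomP) => [[i ->]|[uT|[i ir ui]]].
- by rewrite node_leafE; case: eqP => [_|/eqP ir]; [left | right; exists i].
- by exists r; apply: val_inj; rewrite node_leafE eqxx.
by exists i; apply: val_inj; rewrite node_leafE (negPf ir).
Qed.

Lemma inner_node u : u \notin codom node_leaf ->
  [/\ val u != setT, 1 < #|val u|, r \notin val u & val u = ~: [set r] \/ val u \in G].
Proof.
move=> ul; have uT : val u != setT by apply: contraNneq ul => E; apply/node_leafP; left.
have ru : r \notin val u.
  by have := cluster_top (valP u) uT; rewrite subsetC sub1set inE.
have u1 : #|val u| != 1.
  apply: contraNneq ul => /eqP/cards1P[i ui]; apply/node_leafP; right; exists i => //.
  by apply: contraNneq ru => <-; rewrite ui inE.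
split=> //.
  by rewrite ltn_neqAle eq_sym u1 card_gt0 cluster_neq0 ?(valP u).
case/or3P: (valP u) => [/eqP E|/eqP|/andP[/orP[|]]]; rewrite ?(negPf u1) //; auto.
by rewrite E eqxx in uT.
Qed.

Lemma covers_child I e : cluster I -> I \subset ~: [set r] -> e \in children G I -> covers I e.
Proof.
move=> cI Ir /childrenP[le eI m]; have re : r \notin e.
  have := subset_trans (proper_sub eI) Ir; by rewrite subsetC sub1set inE.
apply/coversP; split=> //; first by rewrite /cluster le re !orbT.
move=> K cK eK KI; apply: contraTeq isT => nKI.
have pKI : K \proper I by rewrite properEneq nKI.
have rK : r \notin K by have := subset_trans KI Ir; rewrite subsetC sub1set inE.
have lK : leg G K.
  case/or3P: cK => [/eqP E|/eqP E|/andP[]//]; first by rewrite E inE in rK.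
  by rewrite -E in Ir; rewrite properE Ir andbF in pKI.
by have E := m K lK pKI (proper_sub eK); rewrite E properxx in eK.
Qed.

Lemma inner_valence u : u \notin codom node_leaf -> 2 < valence node_adj u.
Proof.
move=> /inner_node[uT u2 ru _]; have [v vu _] := parent uT.
have ur : val u \subset ~: [set r] by rewrite subsetC sub1set inE.
have /card_gt1P[e [f [eu fu ef]]] := card_children G u2.
have ce := covers_child (valP u) ur eu; have cf := covers_child (valP u) ur fu.
have cle : cluster e by case/coversP: ce.
have clf : cluster f by case/coversP: cf.
apply/card_gt2P; exists v, (exist _ e cle), (exist _ f clf).
rewrite !inE /node_adj vu ce cf !orbT; split=> //; split=> //.
- apply: contraTneq (covers_proper vu) => ->; rewrite properE negb_and negbK.
  by rewrite (proper_sub (covers_proper ce)) orbT.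
- apply: contraTneq (covers_proper vu) => <-; rewrite properE negb_and negbK.
  by rewrite (proper_sub (covers_proper cf)) orbT.
Qed.

Lemma leaf_valence1 u : u \in codom node_leaf -> valence node_adj u = 1.
Proof.
move=> ul; suff [w Ew] : exists w, [set w' | node_adj u w'] = [set w] by rewrite /valence Ew cards1.
case/node_leafP: ul => [uT|[i ir ui]].
  exists (exist _ (~: [set r]) cluster_topE); apply/setP=> w; rewrite !inE /node_adj uT.
  have -> : covers (val w) setT = false.
    by apply/negP=> /covers_proper; rewrite properE subsetT andbF.
  rewrite orbF; have pT : ~: [set r] \proper setT.
    by rewrite properT; apply/eqP=> /setP/(_ r); rewrite !inE eqxx.
  apply/idP/eqP=> [/coversP[_ cw wT m]|->].
    apply: val_inj => /=; apply/eqP; rewrite eqEproper cluster_top ?(valP w) //; last by rewrite -properT.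
    apply/negP=> /(m _ cluster_topE)/(_ (subsetT _)) E; by rewrite E properxx in pT.
  apply/coversP; split; rewrite ?clusterT ?cluster_topE //=.
  move=> K cK pK _; apply: contraTeq pK => KT.
  by rewrite properE cluster_top // andbF.
have uT : val u != setT by rewrite ui set1_neqT.
have [v vu _] := parent uT; exists v; apply/setP=> w; rewrite !inE /node_adj.
apply/idP/eqP=> [/orP[/coversP[_ cw wu _]|wu]|->]; last by rewrite vu orbT.
  have := proper_card wu; rewrite ui cards1 ltnS leqn0 cards_eq0.
  by rewrite (negPf (cluster_neq0 cw)).
by apply: val_inj; apply: covers_uniq wu vu.
Qed.

Lemma node_leaf_valence u : (valence node_adj u == 1) = (u \in codom node_leaf).
Proof.
apply/idP/idP=> [/eqP u1|/leaf_valence1->//].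
by apply: contraTT isT => /inner_valence; rewrite u1.
Qed.

Lemma node_no_2valent u : valence node_adj u != 2.
Proof.
have [/leaf_valence1->//|/inner_valence] := boolP (u \in codom node_leaf).
by case: eqP => // ->.
Qed.

Definition cluster_tree : marked_tree n :=
  MarkedTree node_adj_sym node_adj_irr node_connected node_acyclic
    node_leaf_inj node_leaf_valence node_no_2valent.

(** From the clusters inside [val u] the only edge leading out is the one from [u] to its parent,
    and that edge is cut. *)
Lemma side_cluster (u v : vertex cluster_tree) : covers (val v) (val u) -> side u v = val u.
Proof.
move=> vu; have /coversP[cv cu puv _] := vu.
have uT : val u != setT.
  by apply: contraTneq puv => ->; rewrite properE subsetT andbF.
have cover_in w w' : covers (val w') (val w) -> val w \proper val u -> val w' \subset val u.
  move=> ww' wu; have /coversP[cw' cw pw m] := ww'.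
  have /orP[//|s] := cluster_chain cw' cu cw (proper_sub pw) (proper_sub wu).
  by rewrite (m _ cu wu s).
have E w : (w \in branch u v) = (val w \subset val u).
  apply/idP/idP => [|wu].
    pose Q (w : vertex cluster_tree) := val (w : node) \subset val u.
    move: w; apply: (@branch_ind _ _ u v Q) => [|a b _ ab ne au]; first exact: subxx.
    rewrite /Q in au *.
    case/orP: ab => [/covers_proper/proper_sub ba|ab]; first exact: subset_trans ba au.
    have [Ea|nau] := eqVneq (val a) (val u); last by apply: cover_in ab _; rewrite properEneq nau.
    have Eau : a = u by apply: val_inj.
    have Ebv : b = v by apply: val_inj; apply: covers_uniq ab _; rewrite Eau.
    by rewrite Eau Ebv eqxx in ne.
  move Em: (#|val u| - #|val w|) => m; elim/ltn_ind: m w wu Em => m IH w wu Em.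
  have [Ew|nwu] := eqVneq w u; first by rewrite Ew; apply: (@branch_refl _ cluster_tree u v).
  have pwu : val w \proper val u by rewrite properEneq wu andbT (inj_eq val_inj).
  have wT : val w != setT.
    by apply: contraTneq pwu => ->; rewrite properE subsetT andbF.
  have [w' ww' pww'] := parent wT; have w'u := cover_in _ _ ww' pwu.
  have w'B : w' \in branch u v.
    apply: (IH _ _ w' w'u (erefl _)); rewrite -Em; apply: ltn_sub2l; last exact: proper_card.
    exact: leq_trans (proper_card pww') (subset_leq_card w'u).
  apply: branch_step w'B _ _; first by rewrite /= /node_adj ww'.
  apply: contraNneq nwu => Ed; have : w \in [set u; v] by rewrite -Ed !inE eqxx orbT.
  rewrite !inE => /orP[//|/eqP wv].
  by rewrite wv properE (proper_sub puv) andbF in pwu.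
apply/setP=> i; rewrite in_side E /= node_leafE; case: eqP => [->|_]; last by rewrite sub1set.
by rewrite subTset (negPf uT); have := cluster_top cu uT; rewrite subsetC sub1set inE => /negPf->.
Qed.

Lemma splits_cluster_tree : splits cluster_tree = G.
Proof.
have [GC G2 _] := split_systemP _ sG.
(* The lower node of a bounded edge cannot be [~: [set r]], since the parent of that node is the
   leaf [r]. *)
have aux (u v : vertex cluster_tree) : u \notin codom node_leaf -> v \notin codom node_leaf ->
    covers (val v) (val u) -> val u \in G.
  move=> ul vl vu; have [_ _ _ [ut|//]] := inner_node ul.
  have [vT _ _ _] := inner_node vl.
  have := covers_proper vu; rewrite ut properE => /andP[_ /negP[]].
  exact: cluster_top (valP v) vT.
have mem (I : {set 'I_n}) : I \in G -> r \notin I -> exists u v : vertex cluster_tree,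
    bounded_edge u v /\ I = side u v.
  move=> IG rI; have cI : cluster I by rewrite /cluster /leg IG rI !orbT.
  have It : I \proper ~: [set r].
    rewrite properEneq subsetC sub1set inE rI andbT.
    apply: contraTneq (G2 _ (GC _ IG)) => ->; by rewrite setCK cards1.
  have [J IJ Jt] := covers_exists cI cluster_topE It.
  have cJ : cluster J by case/coversP: IJ.
  have pIJ := covers_proper IJ.
  pose u : vertex cluster_tree := exist _ I cI; pose v : vertex cluster_tree := exist _ J cJ.
  exists u, v; split; last by rewrite side_cluster.
  have inner (w : node) : 1 < #|val w| -> val w \subset ~: [set r] -> w \notin codom node_leaf.
    move=> w2 wr; apply/node_leafP=> -[wT|[i _ wi]]; last by rewrite wi cards1 in w2.
    by move: wr; rewrite wT subTset => /eqP/setP/(_ r); rewrite !inE eqxx.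
  apply/and3P; split; first by rewrite /= /node_adj IJ orbT.
    by apply: inner; [exact: G2 | exact: proper_sub].
  by apply: inner => //; apply: ltn_trans (proper_card pIJ); apply: G2.
apply/setP=> I; apply/splitsP/idP=> [[u [v [/and3P[/orP[uv|vu] ul vl] ->]]]|IG].
- have vu : adj v u by rewrite /= /node_adj uv orbT.
  by rewrite (side_setC vu) GC // side_cluster // (aux v u).
- by rewrite side_cluster // (aux u v).
have [rI|rI] := boolP (r \in I); last exact: mem.
have [|u [v [uv E]]] := mem (~: I) (GC _ IG); first by rewrite inE rI.
have auv : adj u v by case/and3P: uv.
exists v, u; split; last by rewrite (side_setC auv) -E setCK.
by move: uv; rewrite /bounded_edge adj_sym => /and3P[-> -> ->].
Qed.

End ClusterTree.

Lemma split_system_tree n (G : {set {set 'I_n}}) : 2 < n -> split_system G ->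
  exists C : marked_tree n, splits C = G.
Proof.
move=> n3 sG; have n0 : 0 < n by apply: leq_trans n3.
by exists (cluster_tree (Ordinal n0) n3 sG); apply: splits_cluster_tree.
Qed.

From mathcomp Require Import all_classical reals.
From mathcomp Require Import fintype finset.
Import Order.TTheory.
Local Open Scope ring_scope.

(** * Linear forms and cones in Q_n *)

Section Functionals.
Variables (R : realType) (n : nat).
Implicit Types (x y : {ffun pairs n -> R^o}) (i j k : 'I_n) (I J S : {set 'I_n}).

(** The default 0 makes [coord [set i; i]] vanish, like the distance of a leaf from itself, so that
    [coord_split_vec] holds for [i = j] too. *)
Definition coord S x : R^o := if insub S is Some T then x (T : pairs n) else 0.

Lemma coord_linear S : linear (coord S).
Proof.
move=> c x y; rewrite /coord; case: insubP => [T _ _|_]; first by rewrite !ffunE.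
by rewrite scaler0 addr0.
Qed.

HB.instance Definition _ S :=
  GRing.isLinear.Build R {ffun pairs n -> R^o} R^o _ (coord S) (coord_linear S).

Lemma coord_pair x (T : pairs n) : coord (val T) x = x T.
Proof. by rewrite /coord valK. Qed.

Lemma coord_set1 x i : coord [set i]%SET x = 0.
Proof. by rewrite /coord insubN // cards1. Qed.

Lemma coord_Phi (a : 'I_n -> R) i j : i != j -> coord [set i; j]%SET (Phi a) = a i + a j.
Proof.
move=> ij; rewrite /coord insubT ?cards2 ?ij //= => c2.
rewrite ffunE /= big_setU1 ?inE //= big_set1 //.
Qed.

Definition split_vec I : {ffun pairs n -> R^o} :=
  [ffun T : pairs n => ((#|I :&: val T| == 1%N)%:R : R^o)]%SET.

Lemma coord_split_vec I i j :
  coord [set i; j]%SET (split_vec I) = ((i \in I) (+) (j \in I))%:R.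
Proof.
have [->|ij] := eqVneq i j; first by rewrite setUid coord_set1 addbb.
rewrite /coord insubT ?cards2 ?ij //= => c2.
rewrite ffunE /= setIUr; congr (_%:R).
have E l : (I :&: [set l] = if l \in I then [set l] else set0)%SET.
  by apply/setP=> m; case: ifP => lI; rewrite !inE; case: eqP => [->|]; rewrite ?lI ?andbF.
rewrite !E; case: (i \in I); case: (j \in I); rewrite ?setU0 ?set0U ?cards1 ?cards0 //.
by rewrite cards2 ij.
Qed.

Lemma vI_split_vec I : vI R I = toQ (split_vec I).
Proof. by []. Qed.

Lemma toQ_Phi (a : 'I_n -> R) : toQ (Phi a) = 0.
Proof.
have -> : toQ (Phi a) = toQ 0 by apply/eqP/toQ_eqP; exists a; rewrite subr0.
by apply: (addrI (toQ 0)); rewrite -toQ_add !addr0.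
Qed.

Lemma toQ_linear : linear (@toQ R n).
Proof. by move=> c x y; rewrite toQ_add toQ_scale. Qed.

HB.instance Definition _ := GRing.isLinear.Build R {ffun pairs n -> R^o} (Qn R n) _ (@toQ R n) toQ_linear.

Lemma linear_quotient (l : {linear {ffun pairs n -> R^o} -> R^o}) :
  (forall a : 'I_n -> R, l (Phi a) = 0) ->
  exists L : {linear Qn R n -> R^o}, forall x, L (toQ x) = l x.
Proof.
move=> lPhi; pose L (v : Qn R n) : R^o := l (repr (v : Quotient.quot (@im_Phi R n))).
have LE x : L (toQ x) = l x.
  have /toQ_eqP[a E] : toQ (repr (toQ x : Quotient.quot (@im_Phi R n))) == toQ x.
    by rewrite toQ_repr.
  by apply/eqP; rewrite -subr_eq0 /L -linearB E lPhi.
have Llin : linear L.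
  move=> c u v; rewrite -[u]toQ_repr -[v]toQ_repr -linearP.
  by rewrite !LE linearP.
pose LL := HB.pack_for {linear Qn R n -> R^o} L (GRing.isLinear.Build _ _ _ _ L Llin).
by exists LL.
Qed.

Lemma eq_coord x y : (forall i j, coord [set i; j]%SET x = coord [set i; j]%SET y) -> x = y.
Proof.
move=> E; apply/ffunP=> T; rewrite -!coord_pair.
by have /cards2P[i [j [ij ->]]] := valP T.
Qed.

Lemma split_vecC I : split_vec (~: I)%SET = split_vec I.
Proof.
apply: eq_coord => i j; rewrite !coord_split_vec !inE.
by case: (i \in I); case: (j \in I).
Qed.

Lemma vI_setC I : vI R (~: I)%SET = vI R I.
Proof. by rewrite !vI_split_vec split_vecC. Qed.

Lemma split_vec_singleton i : split_vec [set i]%SET = Phi (fun j => (j == i)%:R).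
Proof.
apply: eq_coord => j l; have [->|jl] := eqVneq j l; first by rewrite finset.setUid !coord_set1.
rewrite coord_split_vec coord_Phi // !inE.
by case: (j =P i) (l =P i) jl => [->|_] [->|_]; rewrite ?eqxx ?addr0 ?add0r.
Qed.

(** This removes the leaf terms from the balancing condition and leaves only generators of the
    cone. *)
Lemma vI_singleton i : vI R [set i]%SET = 0.
Proof. by rewrite vI_split_vec split_vec_singleton toQ_Phi. Qed.

(* The Gromov product at k: on a tree metric, the distance from the leaf k to the
   path between the two leaves of S. *)
Definition gromov k S x : R^o :=
  (\sum_(i in S) coord [set i; k]%SET x - coord S x) / 2%:R.

Lemma gromov_linear k S : linear (gromov k S).
Proof.
move=> c x y; rewrite /gromov linearP.
under eq_bigr => i _ do rewrite linearP.
by rewrite big_split -scaler_sumr /= /GRing.scale /=; field.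
Qed.

HB.instance Definition _ k S :=
  GRing.isLinear.Build R {ffun pairs n -> R^o} R^o _ (gromov k S) (gromov_linear k S).

Lemma pair_avoidingP k S : reflect (exists i j, [/\ i != k, j != k, i != j & S = [set i; j]%SET])
  (pair_avoiding k S).
Proof.
apply: (iffP andP) => [[/cards2P[i [j [ij ->]]]]|[i [j [ik jk ij ->]]]].
  by rewrite !inE negb_or ![k == _]eq_sym => /andP[ik jk]; exists i, j.
by rewrite cards2 ij !inE negb_or ![k == _]eq_sym ik jk.
Qed.

Lemma gromov_pair k i j x : i != j -> gromov k [set i; j]%SET x =
  (coord [set i; k]%SET x + coord [set j; k]%SET x - coord [set i; j]%SET x) / 2%:R.
Proof. by move=> ij; rewrite /gromov big_setU1 ?inE //= big_set1. Qed.

Lemma gromov_Phi k S (a : 'I_n -> R) : pair_avoiding k S -> gromov k S (Phi a) = a k.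
Proof.
case/pair_avoidingP=> i [j [ik jk ij ->]]; rewrite gromov_pair // !coord_Phi //.
by field.
Qed.

Lemma gromov_split_vec k S I : pair_avoiding k S -> k \notin I ->
  gromov k S (split_vec I) = (S \subset I)%:R.
Proof.
case/pair_avoidingP=> i [j [ik jk ij ->]] /negPf kI; rewrite gromov_pair // !coord_split_vec kI.
rewrite subUset !sub1set; case: (i \in I); case: (j \in I) => /=; by field.
Qed.

(** The functionals [gromov k S] are dual to the vectors of the pairs, so they read off
    coefficients. *)
Lemma gromov_split_pair k S S' : pair_avoiding k S -> pair_avoiding k S' ->
  gromov k S (split_vec S') = (S == S')%:R.
Proof.
move=> aS /andP[/eqP c' kS']; rewrite gromov_split_vec //; congr (_%:R).
by case/andP: aS => /eqP c _; rewrite eqEcard c c' leqnn andbT.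
Qed.

(* The differences of the functionals gromov k S descend to Q_n. *)
Definition excess k S0 S x : R^o := gromov k S x - gromov k S0 x.

Lemma excess_linear k S0 S : linear (excess k S0 S).
Proof.
by move=> c x y; rewrite /excess !gromov_linear /GRing.scale /=; ring.
Qed.

HB.instance Definition _ k S0 S :=
  GRing.isLinear.Build R {ffun pairs n -> R^o} R^o _ (excess k S0 S) (excess_linear k S0 S).

Lemma excess_quotient k S0 S : pair_avoiding k S0 -> pair_avoiding k S ->
  exists L : {linear Qn R n -> R^o}, forall x, L (toQ x) = excess k S0 S x.
Proof.
by move=> a0 a; apply: linear_quotient => b; rewrite /= /excess !gromov_Phi // subrr.
Qed.

Definition total_excess k S0 x : R^o := \sum_(S | pair_avoiding k S) excess k S0 S x.

Lemma total_excess_linear k S0 : linear (total_excess k S0).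
Proof.
move=> c x y; rewrite /total_excess.
by under eq_bigr => S _ do rewrite linearP; rewrite big_split -scaler_sumr.
Qed.

HB.instance Definition _ k S0 :=
  GRing.isLinear.Build R {ffun pairs n -> R^o} R^o _ (total_excess k S0) (total_excess_linear k S0).

Lemma total_excess_quotient k S0 : pair_avoiding k S0 ->
  exists L : {linear Qn R n -> R^o}, forall x, L (toQ x) = total_excess k S0 x.
Proof.
move=> a0; apply: linear_quotient => b; rewrite /= /total_excess big1 // => S aS.
by rewrite /excess !gromov_Phi // subrr.
Qed.

(** The Gromov products are coefficients of [toQ x], though not reduced ones; by [sum_vI_pairs] a
    common constant may still be subtracted. *)
Lemma gromov_decomposition k x :
  toQ x = \sum_(S | pair_avoiding k S) gromov k S x *: vI R S.
Proof.
under eq_bigr => S _ do rewrite vI_split_vec -linearZ.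
rewrite -linear_sum; apply/eqP/toQ_eqP.
pose A p : R := \sum_(S | pair_avoiding k S) gromov k S x * (p \in S)%:R.
(* For [p] and [q] other than [k], the sum has coordinate [A p + A q] minus twice the Gromov
   product, that is, minus d(p,k) + d(q,k) - d(p,q). Subtracted from d(p,q), this leaves a function
   of [p] plus the same function of [q]. *)
exists (fun p => coord [set p; k]%SET x - A p); apply: eq_coord => p q.
have [->|pq] := eqVneq p q; first by rewrite finset.setUid !coord_set1.
rewrite linearB linear_sum /= coord_Phi //.
under eq_bigr => S _ do rewrite linearZ /= coord_split_vec.
have Ak : A k = 0 by rewrite /A big1 // => S /andP[_ /negPf->]; rewrite mulr0.
have B : \sum_(S | pair_avoiding k S) (gromov k S x *: ((p \in S) (+) (q \in S))%:R : R^o) =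
    A p + A q - 2%:R * (if pair_avoiding k [set p; q]%SET then gromov k [set p; q]%SET x else 0).
  have -> : (if pair_avoiding k [set p; q]%SET then gromov k [set p; q]%SET x else 0) =
      \sum_(S | pair_avoiding k S) gromov k S x * (S == [set p; q]%SET)%:R.
    case: ifP => [apq|/negP npq].
      by rewrite (bigD1 [set p; q]%SET) //= eqxx mulr1 big1 ?addr0 // => S /andP[_ /negPf->]; rewrite mulr0.
    rewrite big1 // => S aS; case: eqP => [E|_]; last by rewrite mulr0.
    by case: npq; rewrite -E.
  rewrite /A mulr_sumr -!big_split -sumrB /=; apply: eq_bigr => S aS.
  have -> : (S == [set p; q]%SET) = (p \in S) && (q \in S).
    case/andP: aS => /eqP c2 _; rewrite eq_sym eqEcard c2 cards2 pq andbT.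
    by rewrite subUset !sub1set.
  rewrite /GRing.scale /=; case: (p \in S); case: (q \in S) => /=; ring.
rewrite B; case: (boolP (pair_avoiding k _)) => [a|na].
  by rewrite gromov_pair //; field.
have [pk|pk] := eqVneq p k.
  by rewrite pk finset.setUid coord_set1 Ak [[set k; q]%SET]finset.setUC; ring.
have [qk|qk] := eqVneq q k; first by rewrite qk finset.setUid coord_set1 Ak; ring.
by case/negP: na; apply/pair_avoidingP; exists p, q.
Qed.

(** [Phi] of the indicator of [k] is zero in [Qn], yet all its Gromov products at [k] are 1. This
    relation is the freedom that a vanishing coefficient removes in [reduced_repr]. *)
Lemma sum_vI_pairs k : \sum_(S | pair_avoiding k S) vI R S = 0.
Proof.
transitivity (toQ (Phi (fun i => (i == k)%:R : R))); last exact: toQ_Phi.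
rewrite (gromov_decomposition k).
by apply: eq_bigr => S aS; rewrite gromov_Phi // eqxx scale1r.
Qed.

End Functionals.

(** * Recovering splits from cones, and f_k on a cone *)

Section Cones.
Variables (R : realType) (n : nat).
Implicit Types (x y : {ffun pairs n -> R^o}) (i j k : 'I_n) (I J S : {set 'I_n}).
Implicit Types (G : {set {set 'I_n}}).

Lemma generated_coneP G (v : Qn R n) : generated_cone G v ->
  exists2 m : {set 'I_n} -> R, (forall I, 0 <= m I) &
    v = toQ (\sum_(I in G) m I *: split_vec R I).
Proof.
move=> [m [m0 ->]]; exists m => //; rewrite linear_sum.
by apply: eq_bigr => I _; rewrite linearZ.
Qed.

Lemma vI_generated_cone G I : I \in G -> generated_cone G (vI R I).
Proof.
move=> IG; exists (fun J => (J == I)%:R); split=> [J|]; first by rewrite ler0n.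
rewrite (bigD1 I) //= eqxx scale1r big1 ?addr0 // => J /andP[_ /negPf->].
by rewrite scale0r.
Qed.

Lemma sub_generated_cone G G' : G \subset G' ->
  (generated_cone G `<=` generated_cone (R := R) G')%classic.
Proof.
move=> /subsetP s v [m [m0 ->]]; exists (fun J => if J \in G then m J else 0); split.
  by move=> J; case: ifP.
rewrite big_mkcond [RHS]big_mkcond; apply: eq_bigr => J _.
case: ifP => [/s->//|_]; by case: ifP => // _; rewrite scale0r.
Qed.

(** The functional of the four-point condition: 2 on a split with [a], [b] against [c], [d], -2 on
    one with [a], [c] against [b], [d], and 0 on all others. Each label occurs once with each sign,
    so it descends to [Qn]. *)
Definition quartet (a b c d : 'I_n) x : R^o :=
  coord [set a; c]%SET x + coord [set b; d]%SET x
  - coord [set a; b]%SET x - coord [set c; d]%SET x.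

Lemma quartet_linear a b c d : linear (quartet a b c d).
Proof. by move=> t x y; rewrite /quartet !coord_linear /GRing.scale /=; ring. Qed.

HB.instance Definition _ a b c d :=
  GRing.isLinear.Build R {ffun pairs n -> R^o} R^o _ (quartet a b c d) (quartet_linear a b c d).

Lemma quartet_quotient a b c d : a != c -> b != d -> a != b -> c != d ->
  exists L : {linear Qn R n -> R^o}, forall x, L (toQ x) = quartet a b c d x.
Proof.
move=> ac bd ab cd; apply: linear_quotient => f.
by rewrite /= /quartet !coord_Phi //; ring.
Qed.

Lemma quartet_split_vec a b c d I : quartet a b c d (split_vec R I) =
  ((a \in I) (+) (c \in I))%:R + ((b \in I) (+) (d \in I))%:R
  - ((a \in I) (+) (b \in I))%:R - ((c \in I) (+) (d \in I))%:R.
Proof. by rewrite /quartet !coord_split_vec. Qed.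

(** Some [J] in [G] has a positive coefficient. On a quartet that [J] cuts two against two, no split
    compatible with [J] counts negatively. So [I] cuts all these quartets as [J] does, which leaves
    only [J] and its complement. *)
Lemma mem_vI_generated_cone G I : split_system G -> (1 < #|I|)%N -> (1 < #|~: I|%SET)%N ->
  generated_cone G (vI R I) -> I \in G.
Proof.
move=> sG I2 IC2 /generated_coneP[m m0 E].
have [GC G2 Gc] := split_systemP _ sG.
have quartetE a b c d : a != c -> b != d -> a != b -> c != d ->
    quartet a b c d (split_vec R I) = \sum_(J in G) m J * quartet a b c d (split_vec R J).
  move=> ac bd ab cd; have [L LE] := quartet_quotient ac bd ab cd.
  rewrite -LE -vI_split_vec E LE linear_sum; apply: eq_bigr => J _; exact: linearZ.
have [J JG mJ] : exists2 J, J \in G & 0 < m J.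
  case/card_gt1P: I2 => a [b [aI bI ab]]; case/card_gt1P: IC2 => c [d [cI dI cd]].
  rewrite !inE in cI dI.
  have ac : a != c by apply: contraNneq cI => <-.
  have bd : b != d by apply: contraNneq dI => <-.
  have := quartetE a b c d ac bd ab cd.
  rewrite quartet_split_vec aI bI (negPf cI) (negPf dI) /=.
  have [/exists_inP[J JG mJ] _|] := boolP [exists J in G, 0 < m J]; first by exists J.
  rewrite negb_exists => /forallP h; rewrite big1 => [|J JG]; first by lra.
  by move: (h J); rewrite JG /= lt_def m0 andbT negbK => /eqP->; rewrite mul0r.
have split_same a b c d : a \in J -> b \in J -> c \notin J -> d \notin J -> a != b -> c != d ->
    [&& (a \in I) == (b \in I), (c \in I) == (d \in I) & (a \in I) != (c \in I)].
  move=> aJ bJ cJ dJ ab cd.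
  have ac : a != c by apply: contraNneq cJ => <-.
  have bd : b != d by apply: contraNneq dJ => <-.
  have : 0 < quartet a b c d (split_vec R I).
    rewrite quartetE // (bigD1 J) //=; apply: ltr_pwDl.
      by rewrite quartet_split_vec aJ bJ (negPf cJ) (negPf dJ) /=; lra.
    apply: sumr_ge0 => K /andP[KG _]; apply: mulr_ge0 => //; rewrite quartet_split_vec -addrA -opprD subr_ge0 -!natrD ler_nat.
    have := Gc K J KG JG; rewrite /compatible.
    case aK: (a \in K); case bK: (b \in K); case cK: (c \in K); case dK: (d \in K) => //=.
      by case/or4P=> /subsetP h;
        [move: (h c); rewrite cK (negPf cJ) | move: (h a); rewrite inE aK aJ
        | move: (h d); rewrite inE dK (negPf dJ) | move: (h b); rewrite !inE bK bJ] => /(_ isT).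
    by case/or4P=> /subsetP h;
        [move: (h d); rewrite dK (negPf dJ) | move: (h b); rewrite inE bK bJ
        | move: (h c); rewrite inE cK (negPf cJ) | move: (h a); rewrite !inE aK aJ] => /(_ isT).
  rewrite quartet_split_vec -addrA -opprD subr_gt0 -!natrD ltr_nat.
  by case: (a \in I); case: (b \in I); case: (c \in I); case: (d \in I).
have /card_gt1P[a [b [aJ bJ ab]]] := G2 _ JG.
have /card_gt1P[c [d [cJ dJ cd]]] := G2 _ (GC _ JG); rewrite !inE in cJ dJ.
have inJ e : e \in J -> (e \in I) = (a \in I).
  move=> eJ; have [->//|ea] := eqVneq e a.
  by have /and3P[/eqP] := split_same e a c d eJ aJ cJ dJ ea cd.
have outJ e : e \notin J -> (e \in I) = ~~ (a \in I).
  move=> eJ; have [->|ec] := eqVneq e c.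
    by have /and3P[_ _] := split_same a b c d aJ bJ cJ dJ ab cd; case: (a \in I); case: (c \in I).
  have /and3P[_ _] := split_same a b e c aJ bJ eJ cJ ab ec.
  by case: (a \in I); case: (e \in I).
case aI: (a \in I) in inJ outJ.
  suff -> : I = J by [].
  by apply/setP=> e; have [/inJ|/outJ] := boolP (e \in J).
suff -> : I = (~: J)%SET by apply: GC.
by apply/setP=> e; rewrite inE; have [/inJ|/outJ] := boolP (e \in J).
Qed.

Lemma generated_cone_sub G G' : split_system G -> split_system G' ->
  (generated_cone G `<=` generated_cone (R := R) G')%classic -> G \subset G'.
Proof.
move=> sG sG' s; apply/subsetP=> I IG; have [GC G2 _] := split_systemP _ sG.
apply: mem_vI_generated_cone => //; [exact: G2 | exact: G2 (GC _ IG)|].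
by apply: s; apply: vI_generated_cone.
Qed.

Lemma generated_cone_inj G G' : split_system G -> split_system G' ->
  generated_cone (R := R) G = generated_cone G' -> G = G'.
Proof.
move=> sG sG' E; apply/eqP; rewrite eqEsubset.
by rewrite !generated_cone_sub // E.
Qed.

Lemma generated_cone0 : generated_cone (set0 : {set {set 'I_n}}) = [set (0 : Qn R n)]%classic.
Proof.
apply/seteqP; split=> [v [m [_ ->]]|v ->]; first by rewrite big_set0.
by exists (fun=> 0); rewrite big_set0.
Qed.

Section Apart.
Variables (G : {set {set 'I_n}}) (k i0 j0 : 'I_n).
Hypotheses (sG : split_system G) (ap : apart G k i0 j0).
Let S0 := [set i0; j0]%SET.

Lemma apart_pair : pair_avoiding k S0.
Proof. by case: ap => i0k j0k ij _; apply/pair_avoidingP; exists i0, j0. Qed.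

Lemma gromov_ge0 S I : pair_avoiding k S -> 0 <= gromov k S (split_vec R I).
Proof.
move=> aS; have [kI|kI] := boolP (k \in I); last by rewrite gromov_split_vec // ler0n.
by rewrite -split_vecC gromov_split_vec ?inE ?kI // ler0n.
Qed.

Lemma gromov_apart I : I \in G -> gromov k S0 (split_vec R I) = 0.
Proof.
have [GC _ _] := split_systemP _ sG.
have h J : J \in G -> k \notin J -> gromov k S0 (split_vec R J) = 0.
  move=> JG kJ; rewrite gromov_split_vec ?apart_pair // subUset !sub1set.
  by case iJ: (i0 \in J) => //=; case: ap => _ _ _ /(_ J JG kJ iJ)/negPf->.
move=> IG; have [kI|] := boolP (k \in I); last exact: h.
by rewrite -split_vecC h ?GC // inE kI.
Qed.

Lemma excess_cone_ge0 S x : pair_avoiding k S -> generated_cone G (toQ x) -> 0 <= excess k S0 S x.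
Proof.
move=> aS /generated_coneP[m m0 E]; have [L LE] := excess_quotient R apart_pair aS.
rewrite -LE E LE linear_sum; apply: sumr_ge0 => I IG; rewrite linearZ.
by apply: mulr_ge0 => //=; rewrite /excess gromov_apart // subr0 gromov_ge0.
Qed.

(** On the cone the pair [S0] has the least Gromov product, so subtracting it from all of them
    produces the reduced representation. *)
Lemma fk_cone x : generated_cone G (toQ x) -> fk k (toQ x) = total_excess k S0 x.
Proof.
move=> Gx; have a0 := apart_pair; apply: xget_unique.
  exists (fun S => excess k S0 S x) => //; split=> [|S aS|].
  - under eq_bigr => S _ do rewrite scalerBl.
    by rewrite sumrB -scaler_sumr sum_vI_pairs scaler0 subr0 -gromov_decomposition.
  - exact: excess_cone_ge0.
  by exists S0; rewrite // /excess subrr.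
move=> _ [l [El l0 [T aT lT]] ->].
(* By duality any reduced representation, with its zero at [T], consists of the Gromov products
   minus that of [T]. *)
have lE S : pair_avoiding k S -> l S = gromov k S x - gromov k T x.
  move=> aS; have [L LE] := excess_quotient R aT aS.
  rewrite -[RHS]LE El linear_sum /= (eq_bigr (fun S' => l S' * ((S == S')%:R - (T == S')%:R))); last first.
    move=> S' aS'; rewrite linearZ /= vI_split_vec LE /excess !gromov_split_pair //.
  rewrite (bigD1 S) //= eqxx; have [TS|TS] := eqVneq T S.
    rewrite TS in lT *; rewrite lT mul0r add0r big1 // => S' /andP[_]; rewrite eq_sym => /negPf->.
    by rewrite subrr mulr0.
  rewrite subr0 mulr1 (bigD1 T) //=; last by rewrite aT TS.
  rewrite lT mul0r add0r big1 ?addr0 // => S' /andP[/andP[_]].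
  by rewrite ![S' == _]eq_sym => /negPf-> /negPf->; rewrite subrr mulr0.
(* One inequality is [l S0 >= 0], the other that the excess at [T] is nonnegative. *)
have E0 : gromov k T x = gromov k S0 x.
  apply/eqP; rewrite eq_le; apply/andP; split.
    by rewrite -subr_ge0 -lE // l0.
  by rewrite -subr_ge0; apply: excess_cone_ge0.
by apply: eq_bigr => S aS; rewrite lE // E0.
Qed.

Lemma fk_linear_cone : exists2 L : {linear Qn R n -> R^o},
  (forall v, generated_cone G v -> L v = fk k v) & forall x, L (toQ x) = total_excess k S0 x.
Proof.
have [L LE] := total_excess_quotient R apart_pair; exists L => // v.
by rewrite -[v]toQ_repr => Gv; rewrite LE fk_cone.
Qed.

End Apart.

Lemma card_pairs_avoiding k : #|[pred S | pair_avoiding k S]| = 'C(n.-1, 2).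
Proof.
have -> : 'C(n.-1, 2) = #|[set S : {set 'I_n} | S \subset ~: [set k] & #|S| == 2]%SET|.
  by rewrite cards_draws cardsC1 card_ord.
rewrite cardsE; apply: eq_card => S.
by rewrite inE [RHS]unfold_in /pair_avoiding andbC finset.subsetC sub1set inE.
Qed.

(** [linear_on] chooses among the values at [v] of all forms on [Qn] extending [phi]. An extension
    must exist, and all of them must agree at [v], as they do on the span of [sigma]. *)
Lemma linear_onP (phi : Qn R n -> R) (sigma : set (Qn R n)) (v : Qn R n) (r : R) :
  (exists L : {linear Qn R n -> R^o}, forall u, sigma u -> L u = phi u) ->
  (forall L : {linear Qn R n -> R^o}, (forall u, sigma u -> L u = phi u) -> L v = r) ->
  linear_on phi sigma v = r.
Proof.
move=> [L hL] h; apply: xget_unique; first by exists L; rewrite ?h.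
by move=> _ [L' hL' ->]; apply: h.
Qed.

End Cones.

(** * Products of Psi-classes *)

Section PsiProducts.
Variables (R : realType) (n : nat).
Hypothesis n3 : (2 < n)%N.
Implicit Types (i j k x : 'I_n) (I J S : {set 'I_n}) (G : {set {set 'I_n}}) (c : 'I_n -> nat).

Local Notation cone G := (generated_cone (R := R) G).

Lemma del_add_split G I : insertable G I -> split_system G ->
  (add_split G I :\: [set I; ~: I])%SET = G.
Proof.
move=> iI sG; have [IG _ _ _] := insertableP _ sG iI.
have [ICG _ _ _] := insertableP _ sG (etrans (insertableC I sG) iI : insertable G (~: I)%SET).
apply/finset.setP=> J; rewrite !inE.
case: eqP => [->|_]; first by rewrite (negPf IG).
by case: eqP => [->|] //=; rewrite (negPf ICG).
Qed.

Lemma contractionP (sigma tau : set (Qn R n)) I : contraction sigma tau I <->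
  exists G, [/\ split_system G, I \in G, sigma = cone G & tau = cone (G :\: [set I; ~: I])%SET].
Proof.
split=> [[C [x [y [xy -> -> ->]]]]|[G [sG IG -> ->]]].
  by exists (splits C); split=> //; [exact: splits_system | apply/splitsP; exists x, y].
have [C EC] := split_system_tree n3 sG; subst G.
by have /splitsP[x [y [xy EI]]] := IG; exists C, x, y; split.
Qed.

Lemma primitiveE G I : split_system G -> insertable G I ->
  primitive (cone (add_split G I)) (cone G) = vI R I.
Proof.
move=> sG iI; have /andP[_ sG'] := iI; apply: xget_unique.
  exists I => //; apply/contractionP; exists (add_split G I).
  by rewrite del_add_split //; split=> //; rewrite in_add_split eqxx.
move=> _ [J /contractionP[G1 [sG1 JG1 E1 E2]] ->].
have {}E1 := generated_cone_inj sG' sG1 E1; subst G1.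
have E := generated_cone_inj sG (del_split_system J sG1) E2.
have JG : J \notin G by rewrite E !inE eqxx.
move: JG1; rewrite in_add_split (negPf JG) orbF => /orP[/eqP->//|/eqP->].
exact: vI_setC.
Qed.

Definition cone_weight c G : R := (system_weight c G)%:R / (\prod_i (c i)`!)%:R.

(* Z is the product of the Psi-classes with multiplicities c, of which there
   are m. *)
Definition is_psi_product (Z : weighted_fan R n) c m :=
  (forall sigma, facets Z sigma <-> exists G,
     [/\ split_system G, (#|G| + m.*2 = (n - 3).*2)%N, system_weight c G != 0%N & sigma = cone G])
  /\ (forall G, split_system G -> (#|G| + m.*2 = (n - 3).*2)%N ->
     Defs.weight Z (cone G) = cone_weight c G).

Lemma M0n_psi_product : is_psi_product (M0n R n) (fun=> 0%N) 0.
Proof.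
have w1 G : split_system G -> (#|G| + 0.*2 = (n - 3).*2)%N -> system_weight (fun=> 0%N) G = 1%N.
  move=> sG cG; have := @sum_valence 'I_n; rewrite card_ord => /(_ n3 G sG).
  rewrite double0 addn0 in cG; rewrite cG -[RHS]add0n => /addIn/eqP.
  rewrite double_eq0 sum_nat_eq0 => /forall_inP h.
  rewrite /system_weight big1 // => P PG.
  have k0 : ksum (leg_weight (fun=> 0%N)) P = 0%N.
    by rewrite /ksum big1 // => e _; rewrite /leg_weight big1.
  rewrite /vertex_weight k0 eqn_leq (vertex_card PG) andbT.
  by have := h P PG; rewrite subn_eq0 => ->.
split=> [sigma|G sG cG].
  split=> [[C cC ->]|[G [sG cG _ ->]]].
    exists (splits C); have sC := splits_system C.
    have c2 : (#|splits C| + 0.*2 = (n - 3).*2)%N by rewrite double0 addn0 card_splits cC.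
    by split; rewrite // w1.
  have [C EC] := split_system_tree n3 sG; exists C; last by rewrite -EC.
  by apply: double_inj; rewrite -card_splits EC -cG double0 addn0.
by rewrite /= /cone_weight w1 // big1 ?divr1.
Qed.

Lemma sum_insertable_oriented (V : lmodType R) G x (F : {set 'I_n} -> V) : split_system G ->
  (forall I, F (~: I)%SET = F I) ->
  \sum_(I | insertable G I && (x \in I)) F I = 2%:R^-1 *: \sum_(I | insertable G I) F I.
Proof.
move=> sG FC; rewrite [in RHS](bigID (fun I : {set 'I_n} => x \in I)) /=.
have -> : \sum_(I | insertable G I && (x \notin I)) F I =
    \sum_(I | insertable G I && (x \in I)) F I.
  rewrite (reindex_inj (@finset.setC_inj _)) /=; apply: eq_big => [I|I _]; last exact: FC.
  by rewrite insertableC // inE negbK.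
by rewrite scalerDr -scalerDl; rewrite (_ : _ + _ = 1) ?scale1r //; field.
Qed.

Lemma sum_weight_vI G c : split_system G ->
  \sum_(I | insertable G I) (system_weight c (add_split G I))%:R *: vI R I =
  \sum_(P in vertices G) \sum_(e in P)
     (2%:R * (coweight c G P)%:R * leg_coef R c P e) *: vI R e.
Proof.
move=> sG; under eq_bigr => I _ do rewrite vI_split_vec -linearZ.
under [RHS]eq_bigr => P _ do under eq_bigr => e _ do rewrite vI_split_vec -linearZ.
under [RHS]eq_bigr => P _ do rewrite -linear_sum.
rewrite -!linear_sum; congr toQ; apply: eq_coord => p q; rewrite !linear_sum /=.
under eq_bigr => I _ do rewrite linearZ /= coord_split_vec.
under [RHS]eq_bigr => P _.
  rewrite linear_sum; under eq_bigr => e _ do rewrite linearZ /= coord_split_vec.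
  over.
exact: balancing.
Qed.

(* The sum lies in the span of the cone of G. *)
Lemma linear_sum_weight_vI G c (phi : Qn R n -> R) (L L' : {linear Qn R n -> R^o}) :
  split_system G -> (forall v, cone G v -> L v = phi v) -> (forall v, cone G v -> L' v = phi v) ->
  L (\sum_(I | insertable G I) (system_weight c (add_split G I))%:R *: vI R I) =
  L' (\sum_(I | insertable G I) (system_weight c (add_split G I))%:R *: vI R I).
Proof.
move=> sG hL hL'; rewrite sum_weight_vI // !linear_sum; apply: eq_bigr => P PG.
rewrite !linear_sum; apply: eq_bigr => e eP; rewrite !linearZ /=; congr (_ *: _).
have /orP[eG|/cards1P[i ->]] := vertex_leg PG eP; last by rewrite vI_singleton !linear0.
by have Ge := vI_generated_cone R eG; rewrite hL ?hL'.
Qed.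

(** * Multiplication by one Psi-class *)

Section PsiMul.
Variables (Z : weighted_fan R n) (c : 'I_n -> nat) (m : nat) (x : 'I_n).
Hypothesis hZ : is_psi_product Z c m.
Let c' i := (c i + (i == x))%N.

Lemma bin_neq0 : 'C(n.-1, 2)%:R != 0 :> R.
Proof. by rewrite pnatr_eq0 -lt0n bin_gt0 -ltnS prednK //; apply: leq_trans n3. Qed.

Section Codim1.
Variable G : {set {set 'I_n}}.
Hypotheses (sG : split_system G) (cG : (#|G| + m.+1.*2 = (n - 3).*2)%N).

(** Of the two halves of a new split the one containing [x] is kept, so that each facet is listed
    once. *)
Let D := [set I | [&& insertable G I, x \in I & system_weight c (add_split G I) != 0%N]]%SET.

Lemma card_add_split_eq I : insertable G I -> (#|add_split G I| + m.*2 = (n - 3).*2)%N.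
Proof. by move=> iI; rewrite card_add_split // -cG doubleS !addSn !addnS. Qed.

Lemma facets_add I : insertable G I -> system_weight c (add_split G I) != 0%N ->
  facets Z (cone (add_split G I)).
Proof.
move=> iI w; case: hZ => hf _; apply/hf; exists (add_split G I).
by split=> //; [case/andP: iI | exact: card_add_split_eq].
Qed.

Lemma star_bij : set_bij [set` D]%classic
  [set sigma | facets Z sigma /\ (cone G `<=` sigma)]%classic (fun I => cone (add_split G I)).
Proof.
split=> [I|I J|sigma].
- rewrite /= inE => /and3P[iI _ w]; split; first exact: facets_add.
  by apply: sub_generated_cone; apply/fintype.subsetP=> J; rewrite in_add_split => ->; rewrite !orbT.
- move=> /set_mem /=; rewrite inE => /and3P[iI xI _] /set_mem /=; rewrite inE => /and3P[iJ xJ _] E.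
  have /andP[_ sI] := iI; have /andP[JG sJ] := iJ.
  have {}E := generated_cone_inj sI sJ E.
  have : J \in add_split G I by rewrite E in_add_split eqxx.
  rewrite in_add_split (negPf JG) orbF => /orP[/eqP->//|/eqP EJ].
  by move: xJ; rewrite EJ inE xI.
move=> [/(proj1 hZ)[G1 [sG1 cG1 w E]] s]; rewrite E in s *.
have sGG1 := generated_cone_sub sG sG1 s.
have c1 : #|G1| = #|G|.+2 by apply/eqP; rewrite -(eqn_add2r m.*2) cG1 -cG doubleS !addSn !addnS.
have [I0 I0G1 I0G] : exists2 I, I \in G1 & I \notin G.
  by apply/fintype.subsetPn; apply/negP=> /subset_leq_card; rewrite c1 ltnNge leqnSn.
have [GC1 _ _] := split_systemP _ sG1; have [GC _ _] := split_systemP _ sG.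
have [I [IG1 IG xI]] : exists I, [/\ I \in G1, I \notin G & x \in I].
  have [xI|xI] := boolP (x \in I0); first by exists I0.
  exists (~: I0)%SET; rewrite inE xI GC1 //; split=> //.
  by apply: contra I0G => /GC; rewrite finset.setCK.
have sub : add_split G I \subset G1.
  apply/fintype.subsetP=> J; rewrite in_add_split => /or3P[/eqP->//|/eqP->|/(fintype.subsetP sGG1)//].
  exact: GC1.
have iI : insertable G I.
  have [_ G2 Gc] := split_systemP _ sG1.
  apply/(insertableP _ sG); split=> // [||J JG]; [exact: G2|exact: G2 (GC1 _ IG1)|].
  by apply: Gc => //; apply: (fintype.subsetP sGG1).
have E1 : add_split G I = G1.
  apply/eqP; rewrite finset.eqEcard sub /= card_add_split // c1; exact: leqnn.
by exists I; rewrite /= ?E1 // inE iI xI E1.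
Qed.

Lemma star_sum (V : zmodType) (F : set (Qn R n) -> V) :
  \sum_(sigma \in [set sigma | facets Z sigma /\ (cone G `<=` sigma)]%classic) F sigma =
  \sum_(I in D) F (cone (add_split G I)).
Proof.
rewrite (reindex_fsbig _ _ _ _ star_bij).
have -> : [set` D]%classic = [set` enum D]%classic.
  by apply/seteqP; split=> I; rewrite /= mem_enum.
by rewrite -(fsbig_seq _ _ (enum_uniq _)) big_enum.
Qed.

Lemma divisor_weight_cone : divisor_weight (fk x) Z (cone G) = 'C(n.-1, 2)%:R * cone_weight c' G.
Proof.
have in3 : (2 < #|'I_n|)%N by rewrite card_ord.
have [i0 [j0 ap]] := exists_apart sG in3 x.
have [L Lf LE] := fk_linear_cone R sG ap.
pose w I : R := cone_weight c (add_split G I).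
have wC I : w (~: I)%SET = w I by rewrite /w add_splitC.
have wE I : insertable G I -> Defs.weight Z (cone (add_split G I)) = w I.
  by move=> iI; case: hZ => _ -> //; [case/andP: iI | exact: card_add_split_eq].
have sumD (V : lmodType R) (F : {set 'I_n} -> V) :
    \sum_(I in D) w I *: F I = \sum_(I | insertable G I && (x \in I)) w I *: F I.
  rewrite big_mkcond [RHS]big_mkcond; apply: eq_bigr => I _; rewrite inE andbA.
  case: (insertable G I && (x \in I)) => //=; case: eqP => //= w0.
  by rewrite /w /cone_weight w0 mul0r scale0r.
have sumE : \sum_(I in D) w I *: vI R I =
    (2%:R^-1 / (\prod_i (c i)`!)%:R) *:
    \sum_(I | insertable G I) (system_weight c (add_split G I))%:R *: vI R I.
  rewrite sumD (@sum_insertable_oriented _ G x (fun I => w I *: vI R I)) //; last first.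
    by move=> I; rewrite wC vI_setC.
  rewrite -scalerA; congr (_ *: _); rewrite scaler_sumr; apply: eq_bigr => I _.
  by rewrite scalerA mulrC.
rewrite /divisor_weight !star_sum.
have -> : \sum_(I in D) Defs.weight Z (cone (add_split G I)) *:
    primitive (cone (add_split G I)) (cone G) = \sum_(I in D) w I *: vI R I.
  by apply: eq_bigr => I; rewrite inE => /and3P[iI _ _]; rewrite wE // primitiveE.
(* Here the balancing condition enters: all forms agreeing with [fk x] on the cone have the same
   value on the weighted sum of primitive vectors. *)
rewrite (@linear_onP _ _ (fk x) (cone G) _ (L (\sum_(I in D) w I *: vI R I))); first last.
- move=> L' hL'; rewrite sumE !linearZ; congr (_ *: _).
  exact: (@linear_sum_weight_vI G c (fk x)).
- by exists L.
have -> : \sum_(I in D) linear_on (fk x) (cone (add_split G I))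
     (Defs.weight Z (cone (add_split G I)) *: primitive (cone (add_split G I)) (cone G)) =
    \sum_(I in D) w I *: (fk x (vI R I) : R^o).
  apply: eq_bigr => I; rewrite inE => /and3P[iI _ _]; rewrite wE // primitiveE //.
  have /andP[_ sI] := iI; have [i1 [j1 ap1]] := exists_apart sI in3 x.
  have [L1 L1f _] := fk_linear_cone R sI ap1.
  have vC : cone (add_split G I) (vI R I) by apply: vI_generated_cone; rewrite in_add_split eqxx.
  apply: linear_onP; first by exists L1.
  by move=> L' hL'; rewrite linearZ hL'.
rewrite linear_sum -sumrB /=.
(* At [vI R I], [fk x] exceeds [L] by the Gromov product of [i0] and [j0], once for each pair
   avoiding [x]. That product is 1 if [I] separates [x] from both and 0 otherwise. *)
transitivity (\sum_(I in D) w I *: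
    ('C(n.-1, 2)%:R * [&& x \in I, i0 \notin I & j0 \notin I]%:R : R^o)).
  apply: eq_bigr => I; rewrite inE => /and3P[iI xI _].
  rewrite linearZ /GRing.scale /= -mulrBr; congr (_ * _).
  have /andP[_ sI] := iI; have [i1 [j1 ap1]] := exists_apart sI in3 x.
  have vC : cone (add_split G I) (vI R I) by apply: vI_generated_cone; rewrite in_add_split eqxx.
  rewrite vI_split_vec in vC *.
  rewrite (fk_cone sI ap1 vC) LE /total_excess -sumrB.
  rewrite -(card_pairs_avoiding x) mulrC mulr_natr -sumr_const; apply: eq_bigr => S aS.
  rewrite /excess (gromov_apart R sI ap1) ?in_add_split ?eqxx // subr0 opprB addrC subrK.
  rewrite -split_vecC gromov_split_vec ?inE ?xI //; last exact: apart_pair ap.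
  by rewrite subUset !sub1set !inE.
rewrite sumD.
have Ec y : c' y = (c y + (y == x))%N by [].
rewrite /cone_weight -(sum_system_weight_apart sG in3 ap Ec).
(* The factor [(c x).+1] of the splitting sum is exactly what the denominator gains from [c] to
   [c']. *)
have -> : (\prod_i (c' i)`! = (c x).+1 * \prod_i (c i)`!)%N.
  rewrite (bigD1 x) //= [in RHS](bigD1 x) //= /c' eqxx addn1 factS -mulnA; congr (_ * (_ * _))%N.
  by apply: eq_bigr => i /negPf->; rewrite addn0.
rewrite !natrM [X in X / _]mulrC -mulf_div divff ?pnatr_eq0 // mul1r.
rewrite natr_sum mulr_suml mulr_sumr big_mkcondr; apply: eq_bigr => I _.
case: (x \in I) => /=; last by rewrite muln0 mul0r mulr0.
by rewrite natrM /w /cone_weight /GRing.scale /=; ring.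
Qed.

End Codim1.

Lemma psi_mul_product : is_psi_product (psi_mul x Z) c' m.+1.
Proof.
have Wn0 G : split_system G -> (#|G| + m.+1.*2 = (n - 3).*2)%N ->
    (divisor_weight (fk x) Z (cone G) != 0) = (system_weight c' G != 0%N).
  move=> sG cG; rewrite divisor_weight_cone // mulf_eq0 (negPf bin_neq0) /=.
  rewrite /cone_weight mulf_eq0 invr_eq0 !pnatr_eq0 negb_or; apply/andb_idr => _.
  by rewrite -lt0n prodn_gt0 // => i; apply: fact_gt0.
split=> [tau|G sG cG]; last first.
  by rewrite /= divisor_weight_cone // mulrA mulVf ?mul1r // bin_neq0.
split=> [[[sigma Zs [I /contractionP[G1 [sG1 IG1 Es ->]]]] w0]|[G [sG cG w0 ->]]].
  have [_ c1] := hZ; have /(proj1 hZ)[G2 [sG2 cG2 _ E2]] := Zs.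
  rewrite Es in E2; have E := generated_cone_inj sG1 sG2 E2; subst G2.
  have sG := del_split_system I sG1.
  have cG : (#|G1 :\: [set I; ~: I]|%SET + m.+1.*2 = (n - 3).*2)%N.
    rewrite -cG2 -{2}(add_del_split sG1 IG1) card_add_split ?insertable_del //.
    by rewrite doubleS !addSn !addnS.
  by exists (G1 :\: [set I; ~: I])%SET; split=> //; rewrite -Wn0.
split; last by rewrite Wn0.
have in3 : (2 < #|'I_n|)%N by rewrite card_ord.
have [i0 [j0 ap]] := exists_apart sG in3 x.
have Ec y : c' y = (c y + (y == x))%N by [].
(* A nonzero weight makes some term of the splitting sum nonzero, and this exhibits a facet of [Z]
   with the given cone as a face. *)
have := w0; rewrite -(sum_system_weight_apart sG in3 ap Ec) muln_eq0 orbF sum_nat_eq0.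
case/forall_inPn=> I iI; rewrite muln_eq0 negb_or => /andP[wI _].
exists (cone (add_split G I)); first exact: facets_add.
exists I; apply/contractionP; exists (add_split G I); have /andP[_ sI] := iI.
by rewrite del_add_split //; split=> //; rewrite in_add_split eqxx.
Qed.

End PsiMul.

Lemma eq_psi_product Z c1 c2 m : c1 =1 c2 -> is_psi_product Z c1 m -> is_psi_product Z c2 m.
Proof. by move=> /funext ->. Qed.

Lemma psi_prod_product (s : seq 'I_n) :
  is_psi_product (psi_prod R s) (fun i => count_mem i s) (size s).
Proof.
elim: s => [|x s IH] /=; first exact: M0n_psi_product.
apply: eq_psi_product (psi_mul_product x IH) => i /=.
by rewrite addnC eq_sym.
Qed.

End PsiProducts.

(** * The zero-dimensional product *)

Lemma sum_count_mem (T : finType) (s : seq T) : (\sum_i count_mem i s = size s)%N.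
Proof.
elim: s => [|x s IH] /=; first by rewrite big1.
rewrite big_split /= IH -add1n; congr (_ + _)%N.
by rewrite (bigD1 x) //= eqxx big1 // => i; rewrite eq_sym => /negPf->.
Qed.

Theorem corollary4p2 (R : realType) (n : nat) (k : 'I_n -> nat) (s : seq 'I_n)
    (hn : (3 <= n)%N) (hk : (\sum_(i < n) k i)%N = (n - 3)%N)
    (hs : forall i, count_mem i s = k i) :
  facets (psi_prod R s) = [set [set 0]]%classic /\
  weight (psi_prod R s) [set 0]%classic
    = ((n - 3)`!)%:R / (\prod_(i < n) (k i)`!)%:R.
Proof.
have sz : size s = (n - 3)%N.
  by rewrite -sum_count_mem -hk; apply: eq_bigr.
have [hf hw] := eq_psi_product hs (psi_prod_product R hn s).
have s0 : split_system (set0 : {set {set 'I_n}}).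
  by apply/split_systemP; split=> [I|I|I J]; rewrite inE.
have c0 : (#|(set0 : {set {set 'I_n}})%SET| + (size s).*2 = (n - 3).*2)%N.
  by rewrite cards0 sz.
(* The tree without bounded edges has one inner vertex, with [n] legs and exponents adding up to
   [n - 3]. *)
have w0 : system_weight k (set0 : {set {set 'I_n}})%SET = (n - 3)`!%N.
  rewrite /system_weight vertices_set0 ?card_ord // big_set1 /vertex_weight.
  rewrite card_singletons card_ord.
  have -> : ksum (leg_weight k) (singletons 'I_n) = (n - 3)%N.
    rewrite /ksum big_imset /=; last by move=> i j _ _; apply: finset.set1_inj.
    by rewrite -hk; apply: eq_bigr => i _; rewrite leg_weight1.
  by rewrite subnK ?eqxx.
(* The origin is the cone of the empty split system, the only one of the right cardinality. *)
rewrite -generated_cone0 hw // /cone_weight w0; split=> //.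
apply/seteqP; split=> [sigma /hf[G [_ cG _ ->]]|_ ->].
  have /eqP : #|G| = 0%N by apply: (@addIn (size s).*2); rewrite cG sz.
  by rewrite cards_eq0 => /eqP->.
by apply/hf; exists finset.set0; rewrite w0 -lt0n fact_gt0.
Qed.
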